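(* Let $T\subset\mathbb R^2$ be a (non-degenerate) triangle with vertices $p_0,p_1,p_2$, let $X_n$ be a set of $n$ independent uniformly distributed random points of $T$, and let $L_n$ be the length of a longest convex chain (from $p_0$ to $p_2$) in $X_n$. For every $\gamma>0$ there exists a constant $N$ such that for every $n>N$, $$\mathbb P\big(|L_n-\mathbb E L_n|>\gamma\sqrt{\log n}\;n^{1/6}\big)<n^{-\gamma^2/14}.$$
   Context: A subset $Y\subset X_n$ is a convex chain in $T$ (from $p_0$ to $p_2$) if the convex hull of $Y\cup\{p_0,p_2\}$ is a convex polygon with exactly $|Y|+2$ vertices. The length of the convex chain $Y$ is $|Y|$. The distribution of $L_n$ does not depend on the choice of $T$, by affine invariance. *)

(* Defs.v *)
From HB Require Import structures.
From mathcomp Require Import all_boot all_order all_algebra finmap.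
From mathcomp Require Import all_classical all_reals all_analysis.

Set Implicit Arguments.
Unset Strict Implicit.
Unset Printing Implicit Defensive.

Import Order.TTheory GRing.Theory Num.Theory.
Import numFieldNormedType.Exports.

Local Open Scope classical_set_scope.
Local Open Scope card_scope.
Local Open Scope ring_scope.
Local Open Scope convex_scope.

(* The plane, as a left R-module (hence a convex space): the factors are R^o
   because the module structure of a product needs that of its factors. *)
Notation plane R := (R^o * R^o)%type.

(* The same carrier with the product of the Borel sigma-algebras of R. *)
Notation mplane R := (measurableTypeR R * measurableTypeR R)%type.

Definition area (R : realType) (A : set (mplane R)) : \bar R :=
  (@lebesgue_measure R \x @lebesgue_measure R)%E A.

Definition convex_hull (R : realType) (E : lmodType R) (A : set E) : set E :=
  smallest (@convex_set R E) A.

(* The vertices of a convex polygon are its extreme points. *)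
Definition extreme_points (R : realType) (E : lmodType R) (C : set E) : set E :=
  [set x | C x /\
    forall (a b : convex_lmodType E) (t : {i01 R}), C a -> C b ->
      0 < t%:num < 1 -> x = a <| t |> b -> a = x /\ b = x].

Definition triangle (R : realType) (p0 p1 p2 : plane R) : set (plane R) :=
  convex_hull [set p0; p1; p2].

Definition nondegenerate_triangle (R : realType) (p0 p1 p2 : plane R) : Prop :=
  free [:: p1 - p0; p2 - p0].

Definition convex_chain (R : realType) (p0 p2 : plane R)
    (Y : {fset plane R}) : Prop :=
  extreme_points (convex_hull ([set` Y] `|` [set p0; p2])) #= `I_(#|` Y| + 2)%N.

Definition longest_convex_chain (R : realType) (p0 p2 : plane R)
    (S : {fset plane R}) : nat :=
  \max_(Y <- fpowerset S | `[< convex_chain p0 p2 Y >]) #|` Y|.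

Definition sample (R : realType) (Omega : Type) (n : nat)
    (X : 'I_n -> Omega -> plane R) (w : Omega) : {fset plane R} :=
  [fset X i w | i : 'I_n]%fset.

Definition chain_length (R : realType) (Omega : Type) (p0 p2 : plane R)
    (n : nat) (X : 'I_n -> Omega -> plane R) (w : Omega) : R :=
  (longest_convex_chain p0 p2 (sample X w))%:R.

Section random_points.
Local Open Scope ereal_scope.

Definition uniform_on (R : realType) (d : measure_display)
    (Omega : measurableType d) (P : probability Omega R)
    (T : set (mplane R)) (Z : {RV P >-> mplane R}) : Prop :=
  forall A : set (mplane R), measurable A ->
    distribution P Z A = area (A `&` T) / area T.

Definition independent_RVs (R : realType) (d d' : measure_display)
    (Omega : measurableType d) (V : measurableType d')
    (P : probability Omega R) (I : finType) (X : I -> {RV P >-> V}) : Prop :=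
  forall (J : {set I}) (A : I -> set V),
    (forall i, i \in J -> measurable (A i)) ->
    P (\bigcap_(i in [set` J]) (X i @^-1` A i)) =
    \prod_(i in J) P (X i @^-1` A i).

End random_points.

(* Main.v *)
Require Import Defs.
From HB Require Import structures.
From mathcomp Require Import all_boot all_order all_algebra finmap.
From mathcomp Require Import all_classical all_reals all_analysis.
From mathcomp Require Import measurable_realfun.
From mathcomp Require Import ring lra zify.

Set Implicit Arguments.
Unset Strict Implicit.
Unset Printing Implicit Defensive.

Import Order.TTheory GRing.Theory Num.Theory.
Import numFieldNormedType.Exports.

Local Open Scope classical_set_scope.
Local Open Scope ring_scope.

(** The length of a longest convex chain is a configuration function: it is the
largest size of a set J of indices whose points, together with p0 and p2, are
in convex position, and subsets of such a J have the same property.  Deleting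
one sample point lowers the length by 0 or 1, and only the points of one fixed
longest chain can lower it, so the sum of these drops is at most the length.

For such functions the entropy method gives Poisson-type exponential moments.
Entropy is subadditive over independent coordinates ([entropy_subadditive],
proved by averaging out one coordinate at a time).  Applied to exp (x Z) and
to the lengths with one point deleted, it becomes a differential inequality
for the logarithm of the moment generating function, whose integration
([herbst]) yields E exp (x Z) <= exp ((exp x - 1) E Z) for every real x
([config_mgf_le]).  Chernoff's bound then gives, for every M >= E Z, tails of
order exp (- s^2 / (2 M)) as long as s / M is small ([config_concentration]).

For s = gamma (ln n)^(1/2) n^(1/6) this beats n^(- gamma^2 / 14) as soon as
E Z <= c n^(1/3) for some c < 7.  A first moment computation gives c = 6
([mean_config_size_le]).  After the affine map that sends the triangle to the
one with vertices (0,0), (1,0), (1,1), a convex chain listed by increasing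
abscissa has increasing slopes.  Once its first point is chosen, its other
points lie in a smaller triangle, and integrating the k-th power of the area
of that triangle over the first point gives a beta integral
([integral_step_weight]).  Hence k given points form a convex chain in a given
order with probability at most 2^k / (k!^2 (k+1)!) ([ordered_chain_prob]);
there are at most n^k choices of the points and of their order, so a chain of
length k is unlikely once k is a large enough multiple of n^(1/3).

Two facts of plane geometry connect this with extreme points of convex hulls.
A point of a finite set is extreme in the hull exactly when a functional with
rational coefficients separates it strictly from the other points
([extreme_exposed]); this writes convex position with countably many strict
inequalities, hence as a measurable event.  And three points of an exposed
family inside the triangle, taken by increasing abscissa, always turn left,
since otherwise the middle one would lie between the chord of its neighbours
and the side p0 p2 ([exposed_triple]). *)

(** * Independent identically distributed tuples *)

Definition box (n : nat) (V : Type) (A : 'I_n -> set V) : set (n.-tuple V) :=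
  [set t | forall i, A i (tnth t i)].

(** Boxes form a pi-system that generates the product sigma-algebra, so this
determines rho. *)
Definition iid_law (R : realType) (d : measure_display) (V : measurableType d)
    (mu : probability V R) (n : nat) (rho : probability (n.-tuple V) R) : Prop :=
  forall A : 'I_n -> set V, (forall i, measurable (A i)) ->
    rho (box A) = (\prod_(i < n) mu (A i))%E.

(** The index is a natural number, so that averaging over the coordinates of
index below k can be defined by recursion on k. *)
Definition resample (V : Type) (n : nat) (j : nat) (t : n.-tuple V) (v : V) :
  n.-tuple V := [tuple if i == j :> nat then v else tnth t i | i < n].

Section resampling.
Context (R : realType) (d : measure_display) (V : measurableType d).
Context (mu : probability V R) (n : nat).

Lemma tnth_resample (j : nat) (t : n.-tuple V) (v : V) (i : 'I_n) :
  tnth (resample j t v) i = if i == j :> nat then v else tnth t i.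
Proof. by rewrite tnth_mktuple. Qed.

Lemma measurable_resample (j : nat) :
  measurable_fun setT (fun tv : n.-tuple V * V => resample j tv.1 tv.2).
Proof.
apply/measurable_fun_tnthP => i.
rewrite (_ : _ \o _ =
  fun tv : n.-tuple V * V => if i == j :> nat then tv.2 else tnth tv.1 i); last first.
  by apply/funext => tv /=; rewrite tnth_resample.
case: (i == j :> nat); first exact: measurable_snd.
exact: (measurableT_comp (measurable_tnth i) measurable_fst).
Qed.

Lemma measurable_resampler (j : nat) (t : n.-tuple V) :
  measurable_fun setT (resample j t).
Proof.
apply: (measurableT_comp (measurable_resample j) (pair1_measurable t)).
Qed.

Lemma box_setI (A B : 'I_n -> set V) :
  box A `&` box B = box (fun i => A i `&` B i).
Proof.
by apply/seteqP; split => t /= => [[h1 h2] i|h]; [split|split=> i; case: (h i)].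
Qed.

Lemma measurable_box (A : 'I_n -> set V) : (forall i, measurable (A i)) ->
  measurable (box A).
Proof.
move=> mA; rewrite (_ : box A = \bigcap_(i in [set: 'I_n]) ((fun t => tnth t i) @^-1` A i)).
  apply: fin_bigcap_measurable => [|i _]; first exact: finite_finset.
  by rewrite -[_ @^-1` _]setTI; exact: measurable_tnth.
by apply/seteqP; split => t /= h i; [move=> _|]; exact: h.
Qed.

Lemma measurable_tuple_box :
  @measurable _ (n.-tuple V) = <<s [set box A | A in [set A : 'I_n -> set V | forall i, measurable (A i)]] >>.
Proof.
apply/seteqP; split.
  apply: smallest_sub; first exact: smallest_sigma_algebra.
  rewrite -bigcup_seq => B [i _ [A mA <-]]; apply: sub_sigma_algebra.
  exists (fun k => if k == i then A else setT).
    by move=> k /=; case: ifP.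
  apply/seteqP; split => t /=.
    by move=> /(_ i); rewrite eqxx.
  by move=> [_ At] k; case: eqP => // ->.
apply: smallest_sub; first exact: sigma_algebra_measurable.
by move=> _ [A mA <-]; exact: measurable_box.
Qed.

Lemma tuple_measure_unique (m1 m2 : probability (n.-tuple V) R) :
  (forall A : 'I_n -> set V, (forall i, measurable (A i)) -> m1 (box A) = m2 (box A)) ->
  forall B, measurable B -> m1 B = m2 B.
Proof.
move=> m12 B mB.
apply: (measure_unique [set box A | A in [set A : 'I_n -> set V | forall i, measurable (A i)]] (fun=> setT)) => //.
- exact: measurable_tuple_box.
- move=> _ _ [A mA <-] [C mC <-]; exists (fun i => A i `&` C i).
    by move=> i /=; apply: measurableI.
  by rewrite box_setI.
- by move=> _; exists (fun=> setT) => //; apply/seteqP; split.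
- by rewrite bigcup_const.
- by move=> _ [A mA <-]; exact: m12.
- by move=> _; apply: (le_lt_trans (@probability_le1 _ _ _ m1 _ measurableT)); rewrite ltry.
Qed.

Context (rho : probability (n.-tuple V) R) (rhoP : iid_law mu rho).

Let sub (j : nat) (tv : n.-tuple V * V) := resample j tv.1 tv.2.

(** Substituting an independent copy for coordinate j turns the event that the
tuple lies in a box into a rectangle, in which the side j of the box has moved
to the second factor. *)
Lemma resample_law (j : 'I_n) (B : set (n.-tuple V)) : measurable B ->
  (rho \x mu)%E (sub j @^-1` B) = rho B.
Proof.
move=> mB.
have msub : measurable_fun setT (sub j) by exact: measurable_resample.
pose f : {RV (rho \x mu)%E >-> n.-tuple V} := mfun_Sub (mem_set msub).
apply: (@tuple_measure_unique (distribution (rho \x mu)%E f) rho) => // A mA.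
rewrite /distribution /pushforward /=.
pose A' (i : 'I_n) := if i == j then setT else A i.
have -> : sub j @^-1` box A = box A' `*` A j.
  apply/seteqP; split => [[t v] /= h|[t v] /= [h1 h2] i].
    split; last by have := h j; rewrite /sub tnth_resample eqxx.
    by move=> i; have := h i; rewrite /A' /sub tnth_resample /= val_eqE; case: eqP.
  rewrite /sub tnth_resample val_eqE; case: eqP => [->//|/eqP ij].
  by have := h1 i; rewrite /A' (negbTE ij).
have mA' i : measurable (A' i) by rewrite /A'; case: ifP.
rewrite product_measure1E; [|exact: measurable_box|exact: mA].
rewrite -/(rho (box A)) (rhoP mA) [LHS](_ : _ = (rho (box A') * mu (A j))%E) // (rhoP mA').
rewrite (bigD1 j) //= [RHS](bigD1 j) //= {1}/A' eqxx probability_setT mul1e muleC.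
by congr (_ * _)%E; apply: eq_bigr => i ij; rewrite /A' (negbTE ij).
Qed.

(** Independence is used below only in this form: any single coordinate can be
integrated out first, the other coordinates staying in place. *)
Lemma ge0_integral_resample (j : 'I_n) (h : n.-tuple V -> \bar R) :
  measurable_fun [set: n.-tuple V] h -> (forall t, 0 <= h t)%E ->
  (\int[rho]_t h t = \int[rho]_t \int[mu]_v h (resample j t v))%E.
Proof.
move=> mh h0.
have msub : measurable_fun setT (sub j) by exact: measurable_resample.
pose f : {RV (rho \x mu)%E >-> n.-tuple V} := mfun_Sub (mem_set msub).
rewrite -(@fubini_tonelli1 _ _ _ _ _ rho mu (fun x => h (sub j x))); last 2 first.
- exact: (measurableT_comp mh msub).
- by move=> x; exact: h0.
rewrite -(ge0_integral_distribution f) //.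
by apply: eq_measure_integral => A mA _ /=; rewrite -(resample_law j mA).
Qed.

End resampling.

(** * Means of bounded measurable functions *)

Definition bounded_measurable (R : realType) (d : measure_display)
    (T : measurableType d) (f : T -> R) : Prop :=
  measurable_fun setT f /\ exists M, forall x, `|f x| <= M.

Section bounded_measurable.
Context (R : realType) (d : measure_display) (T : measurableType d).
Context (P : probability T R).
Implicit Types f g : T -> R.

Lemma bmeas_integrable f : bounded_measurable f ->
  P.-integrable setT (EFin \o f).
Proof.
move=> [mf [M fM]]; apply: measurable_bounded_integrable => //.
  by apply: (le_lt_trans (@probability_le1 _ _ _ P _ measurableT)); rewrite ltry.
by exists M; split; [exact: num_real|move=> x Mx t _; exact: le_trans (fM t) (ltW Mx)].
Qed.

Lemma bmeas_cst (c : R) : bounded_measurable (cst c : T -> R).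
Proof. by split; [exact: measurable_cst|exists `|c|]. Qed.

Lemma bmeasD f g : bounded_measurable f -> bounded_measurable g ->
  bounded_measurable (fun x => f x + g x).
Proof.
move=> [mf [M fM]] [mg [N gN]]; split; first exact: measurable_funD.
by exists (M + N) => x; rewrite (le_trans (ler_normD _ _)) // lerD.
Qed.

Lemma bmeasB f g : bounded_measurable f -> bounded_measurable g ->
  bounded_measurable (fun x => f x - g x).
Proof.
move=> [mf [M fM]] [mg [N gN]]; split; first exact: measurable_funB.
by exists (M + N) => x; rewrite (le_trans (ler_normB _ _)) // lerD.
Qed.

Lemma bmeasM f g : bounded_measurable f -> bounded_measurable g ->
  bounded_measurable (fun x => f x * g x).
Proof.
move=> [mf [M fM]] [mg [N gN]]; split; first exact: measurable_funM.
by exists (M * N) => x; rewrite normrM ler_pM.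
Qed.

Lemma bmeas_itv f (a b : R) : measurable_fun setT f ->
  (forall x, a <= f x <= b) -> bounded_measurable f.
Proof.
move=> mf fab; split=> //; exists (`|a| + `|b|) => x.
have /andP[h1 h2] := fab x; rewrite ler_norml.
have := ler_norm (- a); have := ler_norm b; rewrite normrN => nb na.
have a0 := normr_ge0 a; have b0 := normr_ge0 b.
by apply/andP; split; lra.
Qed.

Lemma bmeas_ln f (a b : R) : 0 < a -> measurable_fun setT f ->
  (forall x, a <= f x <= b) -> bounded_measurable (fun x => ln (f x)).
Proof.
move=> a0 mf fab; apply: (@bmeas_itv _ (ln a) (ln b)).
  exact: (measurableT_comp (@measurable_ln R) mf).
move=> x; have /andP[h1 h2] := fab x.
have fx0 : 0 < f x by exact: lt_le_trans h1.
by rewrite !ler_ln ?posrE ?h1 ?h2 // (lt_le_trans fx0).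
Qed.

Lemma bmeas_inv f (a b : R) : 0 < a -> measurable_fun setT f ->
  (forall x, a <= f x <= b) -> bounded_measurable (fun x => (f x)^-1).
Proof.
move=> a0 mf fab.
rewrite (_ : (fun _ => _) = (fun x => expR (- ln (f x)))).
  have [ml _] := bmeas_ln a0 mf fab.
  apply: (@bmeas_itv _ 0 a^-1).
    apply: (measurableT_comp (@measurable_expR R)).
    exact: (measurableT_comp (@oppr_measurable R setT) ml).
  move=> x; have /andP[h1 h2] := fab x.
  have fx0 : 0 < f x by exact: lt_le_trans h1.
  by rewrite expR_ge0 /= expRN lnK ?posrE // lef_pV2 ?posrE.
apply/funext => x; have /andP[h1 h2] := fab x.
have fx0 : 0 < f x by exact: lt_le_trans h1.
by rewrite expRN lnK ?posrE.
Qed.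

Lemma bmeas_sum (n : nat) (f : 'I_n -> T -> R) :
  (forall i, bounded_measurable (f i)) ->
  bounded_measurable (fun x => \sum_i f i x).
Proof.
elim: n f => [|n IH] f bf.
  rewrite (_ : (fun _ => _) = cst 0); first exact: bmeas_cst.
  by apply/funext => x; rewrite big_ord0.
rewrite (_ : (fun _ => _) = (fun x => \sum_i f (widen_ord (leqnSn n) i) x + f ord_max x)).
  by apply: bmeasD => //; apply: IH.
by apply/funext => x; rewrite big_ord_recr.
Qed.

Lemma bmean_cst (c : R) : \int[P]_x (cst c x) = c.
Proof. by rewrite Rintegral_cst // [X in fine X](@probability_setT _ _ _ P) mulr1. Qed.

Lemma bmeanD f g : bounded_measurable f -> bounded_measurable g ->
  \int[P]_x (f x + g x) = \int[P]_x f x + \int[P]_x g x.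
Proof. by move=> bf bg; rewrite RintegralD //; exact: bmeas_integrable. Qed.

Lemma bmeanB f g : bounded_measurable f -> bounded_measurable g ->
  \int[P]_x (f x - g x) = \int[P]_x f x - \int[P]_x g x.
Proof. by move=> bf bg; rewrite RintegralB //; exact: bmeas_integrable. Qed.

Lemma bmeanZ f (c : R) : bounded_measurable f ->
  \int[P]_x (c * f x) = c * \int[P]_x f x.
Proof. by move=> bf; rewrite RintegralZl //; exact: bmeas_integrable. Qed.

Lemma bmean_sum (n : nat) (f : 'I_n -> T -> R) :
  (forall i, bounded_measurable (f i)) ->
  \int[P]_x (\sum_i f i x) = \sum_i \int[P]_x f i x.
Proof.
elim: n f => [|n IH] f bf.
  rewrite big_ord0 -[RHS](bmean_cst 0); apply: eq_Rintegral => x _.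
  by rewrite big_ord0.
rewrite big_ord_recr /= -IH // -bmeanD //; last exact: bmeas_sum.
by apply: eq_Rintegral => x _; rewrite big_ord_recr.
Qed.

Lemma bmean_le f g : bounded_measurable f -> bounded_measurable g ->
  (forall x, f x <= g x) -> \int[P]_x f x <= \int[P]_x g x.
Proof.
move=> bf bg fg; apply: le_Rintegral => //; first exact: bmeas_integrable.
exact: bmeas_integrable.
Qed.

Lemma bmean_EFin f : bounded_measurable f ->
  (\int[P]_x (f x)%:E)%E = (\int[P]_x f x)%:E.
Proof.
by move=> bf; rewrite fineK //; apply: integrable_fin_num => //; exact: bmeas_integrable.
Qed.

Lemma bmean_itv f (a b : R) : measurable_fun setT f ->
  (forall x, a <= f x <= b) -> a <= \int[P]_x f x <= b.
Proof.
move=> mf fab; have bf := bmeas_itv mf fab.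
rewrite -{1}[a]bmean_cst -[X in _ <= _ <= X]bmean_cst.
by apply/andP; split; apply: bmean_le => //; try exact: bmeas_cst;
  move=> x; have /andP[] := fab x.
Qed.

End bounded_measurable.

Section averaging.
Context (R : realType) (d : measure_display) (V : measurableType d).
Context (mu : probability V R) (n : nat).
Context (rho : probability (n.-tuple V) R) (rhoP : iid_law mu rho).

(** The conditional expectation of f given the coordinates other than j. *)
Definition average (j : nat) (f : n.-tuple V -> R) (t : n.-tuple V) : R :=
  \int[mu]_v f (resample j t v).

Lemma average_itv (j : nat) (f : n.-tuple V -> R) (a b : R) :
  measurable_fun setT f -> (forall t, a <= f t <= b) ->
  forall t, a <= average j f t <= b.
Proof.
move=> mf fab t; apply: bmean_itv => [|v]; last exact: fab.
exact: (measurableT_comp mf (measurable_resampler j t)).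
Qed.

Lemma measurable_average (j : nat) (f : n.-tuple V -> R) (b : R) :
  measurable_fun setT f -> (forall t, 0 <= f t <= b) ->
  measurable_fun setT (average j f).
Proof.
move=> mf fb.
pose g (tv : n.-tuple V * V) := (f (resample j tv.1 tv.2))%:E.
have mg : measurable_fun setT g.
  apply/measurable_EFinP; exact: (measurableT_comp mf (measurable_resample j)).
have g0 x : (0 <= g x)%E by rewrite lee_fin; have /andP[] := fb (resample j x.1 x.2).
have := @measurable_fun_fubini_tonelli_F _ _ _ _ _ mu g mg g0.
by move=> /(measurableT_comp (@fine_measurable R setT measurableT)).
Qed.

Lemma mean_average (j : 'I_n) (f : n.-tuple V -> R) (b : R) :
  measurable_fun setT f -> (forall t, 0 <= f t <= b) ->
  \int[rho]_t average j f t = \int[rho]_t f t.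
Proof.
move=> mf fb.
rewrite /Rintegral (@ge0_integral_resample _ _ _ _ _ _ rhoP j (EFin \o f)); first last.
- by move=> t; rewrite lee_fin; have /andP[] := fb t.
- exact/measurable_EFinP.
congr fine; apply: eq_integral => t _; rewrite bmean_EFin //.
apply: (@bmeas_itv _ _ _ _ 0 b) => [|v]; last exact: fb.
exact: (measurableT_comp mf (measurable_resampler j t)).
Qed.

End averaging.

(** * Subadditivity of entropy *)

Section entropy.
Context (R : realType) (d : measure_display) (V : measurableType d).
Context (mu : probability V R) (n : nat).
Context (rho : probability (n.-tuple V) R) (rhoP : iid_law mu rho).

(** This is ln z <= z - 1 at z = g u / f.  It is the variational formula for
entropy: f ln g is traded against the mean of g u, where g will be a ratio of
two consecutive averages of f, whose conditional mean is 1. *)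
Lemma mul_ln_le (f g u : R) : 0 < f -> 0 < g -> 0 < u ->
  f * ln g <= (f * (ln f - ln u) - f + u) + (g * u - u).
Proof.
move=> f0 g0 u0.
have z0 : 0 < g * u / f by rewrite divr_gt0 // mulr_gt0.
have /(ler_wpM2l (ltW f0)) := expR_ge1Dx (ln (g * u / f)).
rewrite lnK ?posrE // [X in _ <= X]mulrC divfK ?gt_eqF // ln_div ?posrE ?mulr_gt0 //.
rewrite lnM ?posrE // => h; lra.
Qed.

Fixpoint average_upto (k : nat) (f : n.-tuple V -> R) : n.-tuple V -> R :=
  if k is k'.+1 then average mu k' (average_upto k' f) else f.

Context (f : n.-tuple V -> R) (a b : R).
Hypotheses (a0 : 0 < a) (mf : measurable_fun setT f)
  (fab : forall t, a <= f t <= b).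

Let F k := average_upto k f.

(** Bounds away from 0 and infinity keep logarithms and quotients of averages
bounded, hence integrable. *)
Lemma average_upto_itv k : measurable_fun setT (F k) /\ forall t, a <= F k t <= b.
Proof.
elim: k => [|k [mF Fab]]; first by [].
split; last by move=> t; exact: average_itv.
apply: (@measurable_average _ _ _ _ _ _ _ b) => // t; have /andP[h ->] := Fab t.
by rewrite andbT (le_trans (ltW a0)).
Qed.

Let F_gt0 k t : 0 < F k t.
Proof. by have [_ /(_ t) /andP[h _]] := average_upto_itv k; exact: lt_le_trans h. Qed.

Lemma average_upto_local k (t t' : n.-tuple V) :
  (forall i : 'I_n, (k <= i)%N -> tnth t i = tnth t' i) -> F k t = F k t'.
Proof.
elim: k t t' => [|k IH] t t' tt'.
  by congr f; apply: eq_from_tnth => i; exact: tt'.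
apply: eq_Rintegral => v _; apply: IH => i ki; rewrite !tnth_resample.
by case: eqP => // /eqP ik; apply: tt'; rewrite ltn_neqAle eq_sym ik.
Qed.

Lemma mean_average_upto k : (k <= n)%N -> \int[rho]_t F k t = \int[rho]_t f t.
Proof.
elim: k => // k IH kn; rewrite -IH; last exact: ltnW.
have [mF Fab] := average_upto_itv k.
rewrite -(@mean_average _ _ _ _ _ _ rhoP (Ordinal kn) (F k) b) // => t.
by have /andP[h ->] := Fab t; rewrite andbT (le_trans (ltW a0)).
Qed.

(** The full average is independent of all coordinates, so it is a constant,
namely the mean. *)
Lemma average_uptoT t : F n t = \int[rho]_t f t.
Proof.
rewrite -(mean_average_upto (leqnn n)) -[LHS](bmean_cst rho).
by apply: eq_Rintegral => t' _; apply: average_upto_local => i; rewrite leqNgt ltn_ord.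
Qed.

Context (u : 'I_n -> n.-tuple V -> R).
Hypotheses (mu_ : forall i, measurable_fun setT (u i))
  (uab : forall i t, a <= u i t <= b)
  (u_local : forall i t v, u i (resample i t v) = u i t).

Let bF k : bounded_measurable (F k).
Proof. by have [mF Fab] := average_upto_itv k; exact: bmeas_itv Fab. Qed.

Let bu i : bounded_measurable (u i).
Proof. exact: bmeas_itv (uab i). Qed.

Let bVF k : bounded_measurable (fun t => (F k t)^-1).
Proof. by have [mF Fab] := average_upto_itv k; exact: bmeas_inv Fab. Qed.

Let blnF k : bounded_measurable (fun t => ln (F k t)).
Proof. by have [mF Fab] := average_upto_itv k; exact: bmeas_ln Fab. Qed.

Let blnu i : bounded_measurable (fun t => ln (u i t)).
Proof. exact: bmeas_ln (uab i). Qed.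

(** Both the denominator and u i ignore coordinate i, so averaging over that
coordinate replaces the numerator by the denominator. *)
Lemma mean_average_ratio (i : 'I_n) :
  \int[rho]_t (F i t / F i.+1 t * u i t) = \int[rho]_t u i t.
Proof.
have bg : bounded_measurable (fun t => F i t / F i.+1 t * u i t).
  by do 2 apply: bmeasM => //.
have [mg [M gM]] := bg.
rewrite -(@mean_average _ _ _ _ _ _ rhoP i (fun t => F i t / F i.+1 t * u i t) M) //.
  apply: eq_Rintegral => t _; rewrite /average.
  transitivity (\int[mu]_v (u i t / F i.+1 t * F i (resample i t v))).
    apply: eq_Rintegral => v _; rewrite u_local.
    rewrite (_ : F i.+1 (resample i t v) = F i.+1 t); first by ring.
    apply: average_upto_local => k ik; rewrite tnth_resample.
    by rewrite gtn_eqF.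
  have [mF Fab] := average_upto_itv i.
  rewrite bmeanZ; last first.
    apply: (@bmeas_itv _ _ _ _ a b); last by move=> v; exact: Fab.
    exact: (measurableT_comp mF (measurable_resampler i t)).
  by rewrite -[X in _ / _ * X]/(F i.+1 t) divfK // gt_eqF.
move=> t; rewrite (le_trans (ler_norm _) (gM t)) andbT.
have /andP[au _] := uab i t.
by apply: mulr_ge0; [apply: ltW; apply: divr_gt0|apply: le_trans (ltW a0) au].
Qed.

(** The entropy of f is the mean of f (ln F_0 - ln F_n), where F_k averages f
over the coordinates of index below k.  This telescopes, and by [mul_ln_le] and
[mean_average_ratio] the term of index i is at most the i-th mean on the
right. *)
Lemma entropy_subadditive :
  \int[rho]_t (f t * ln (f t)) - (\int[rho]_t f t) * ln (\int[rho]_t f t) <=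
  \sum_(i < n) \int[rho]_t (f t * (ln (f t) - ln (u i t)) - f t + u i t).
Proof.
have bf : bounded_measurable f := bF 0.
set m := \int[rho]_t f t.
have -> : \int[rho]_t (f t * ln (f t)) - m * ln m =
   \sum_(i < n) \int[rho]_t (f t * (ln (F i t) - ln (F i.+1 t))).
  rewrite -bmean_sum; last by move=> i; apply: bmeasM => //; apply: bmeasB.
  rewrite [X in _ - X]mulrC -bmeanZ // -bmeanB //; last 2 first.
  - by apply: bmeasM => //; exact: (blnF 0).
  - by apply: bmeasM => //; exact: bmeas_cst.
  apply: eq_Rintegral => t _; rewrite -mulr_sumr.
  rewrite -(big_mkord xpredT (fun i => ln (F i t) - ln (F i.+1 t))).
  under eq_bigr do rewrite -opprB.
  rewrite sumrN telescope_sumr // opprB.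
  by rewrite average_uptoT mulrBr [ln m * _]mulrC.
apply: ler_sum => i _.
pose g t := F i t / F i.+1 t.
have bg : bounded_measurable g by apply: bmeasM.
have bPsi : bounded_measurable
    (fun t => f t * (ln (f t) - ln (u i t)) - f t + u i t).
  apply: bmeasD => //; apply: bmeasB => //; apply: bmeasM => //; apply: bmeasB => //.
  exact: (blnF 0).
have bgu : bounded_measurable (fun t => g t * u i t - u i t).
  by apply: bmeasB => //; apply: bmeasM.
apply: (@le_trans _ _ (\int[rho]_t ((f t * (ln (f t) - ln (u i t)) - f t + u i t)
     + (g t * u i t - u i t)))).
  apply: bmean_le.
  - by apply: bmeasM => //; apply: bmeasB.
  - exact: bmeasD.
  - move=> t; rewrite -ln_div ?posrE //; apply: mul_ln_le.
    + exact: (F_gt0 0).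
    + exact: divr_gt0.
    + by have /andP[h _] := uab i t; exact: lt_le_trans h.
rewrite bmeanD // [X in _ + X]bmeanB //; last exact: bmeasM.
by rewrite mean_average_ratio subrr addr0.
Qed.

End entropy.

(** * Integrating the entropy inequality *)

(** F stands for a moment generating function x |-> E exp (x Z), dF for its
derivative and m for the mean of Z.  The differential inequality says that
K = ln F / (exp - 1) is nonincreasing on each side of 0, and the expansion at 0
identifies the limit of K there as m; both together give the moment generating
function of a Poisson variable of mean m as a bound for F. *)
Section herbst.
Context (R : realType) (F dF : R -> R) (m C eta : R).
Hypotheses (F_gt0 : forall x, 0 < F x)
  (F_derive : forall x : R, is_derive x 1 F (dF x))
  (F_ineq : forall x, (1 - expR (- x)) * dF x <= F x * ln (F x))
  (m0 : 0 <= m) (C0 : 0 <= C) (eta0 : 0 < eta)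
  (F_small : forall x, `|x| <= eta -> F x <= 1 + x * m + x ^+ 2 * C).

Let K x := ln (F x) / (expR x - 1).

Let expR1_neq0 (x : R) : x != 0 -> expR x - 1 != 0 :> R.
Proof. by move=> x0; rewrite subr_eq0 -expR0; apply: contra_neq x0 => /expR_inj. Qed.

Let dK x := (dF x / F x * (expR x - 1) - ln (F x) * expR x) / (expR x - 1) ^+ 2.

Let K_derive (x : R) : x != 0 -> is_derive x 1 K (dK x).
Proof.
move=> x0; have ne := expR1_neq0 x0.
have d1 : is_derive x 1 (fun y => ln (F y)) ((F x)^-1 * dF x).
  exact: is_derive1_comp (is_derive1_ln (F_gt0 x)) (F_derive x).
have d2 : is_derive x 1 (fun y => expR y - 1) (expR x).
  have := is_deriveB (is_derive_expR x) (is_derive_cst (1 : R) x 1).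
  by rewrite subr0.
have d3 := @is_deriveV R (fun y => expR y - 1) x (expR x) 1 ne d2.
have := is_deriveM d1 d3.
rewrite (_ : _ *: _ + _ = dK x) //.
rewrite /dK /= /GRing.scale /=.
field; rewrite ne /=; exact: lt0r_neq0.
Qed.

Let dK_le0 (x : R) : x != 0 -> dK x <= 0.
Proof.
move=> x0; rewrite /dK; apply: mulr_le0_ge0; last by rewrite invr_ge0 sqr_ge0.
have -> : dF x / F x * (expR x - 1) - ln (F x) * expR x =
  expR x / F x * ((1 - expR (- x)) * dF x - F x * ln (F x)).
  have e0 := lt0r_neq0 (expR_gt0 x); have F0 := lt0r_neq0 (F_gt0 x).
  by rewrite expRN; field; rewrite ?e0 ?F0.
apply: mulr_ge0_le0; first by rewrite divr_ge0 ?expR_ge0 ?ltW.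
by rewrite subr_le0.
Qed.

Let K_nincr (x y : R) : x < y -> (y < 0) || (0 < x) -> K y <= K x.
Proof.
move=> xy /orP xy0.
have ne z : x <= z -> z <= y -> z != 0.
  move=> xz zy; case: xy0 => h; first by rewrite lt_eqF // (le_lt_trans zy).
  by rewrite gt_eqF // (lt_le_trans h).
have [z zxy||c cxy E] := @MVT _ K dK x y xy.
- by apply: K_derive; apply: ne; rewrite ltW // (itvP zxy).
- apply: derivable_within_continuous => z zxy.
  have zn : z != 0 by apply: ne; rewrite (itvP zxy).
  by have [] := K_derive zn.
rewrite -subr_le0 E; apply: mulr_le0_ge0; last by rewrite subr_ge0 ltW.
by apply/dK_le0/ne; rewrite ltW // (itvP cxy).
Qed.

(** Only an upper bound for F near 0 is available, yet it serves on both sides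
of 0 because exp x - 1 changes sign there. *)
Let lnF_small (x : R) : `|x| <= eta -> ln (F x) <= x * m + x ^+ 2 * C.
Proof.
move=> /F_small h; have := @le_ln1Dx _ (F x - 1).
rewrite (_ : 1 + (F x - 1) = F x); last by ring.
move=> /(_ _)/le_trans; apply; last lra.
by have := F_gt0 x; lra.
Qed.

Lemma herbst_pos (x : R) : 0 < x -> ln (F x) <= (expR x - 1) * m.
Proof.
have := m0; have := C0; have := eta0 => eta_gt0 C_ge0 m_ge0.
move=> x0.
have ex0 : 0 < expR x - 1 by rewrite subr_gt0 -expR0 ltr_expR.
rewrite mulrC -ler_pdivrMr //; apply/ler_addgt0Pr => e e0.
have C1 : 0 < C + 1 by lra.
pose s := Num.min (x / 2) (Num.min eta (e / (C + 1))).
have s0 : 0 < s by rewrite !lt_min eta0 !divr_gt0.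
have sx : s < x.
  by have : s <= x / 2; [rewrite ge_min lexx|lra].
have seta : s <= eta by rewrite !ge_min lexx orbT.
have sC : s * C <= e.
  have : s <= e / (C + 1) by rewrite !ge_min lexx !orbT.
  by rewrite ler_pdivlMr // => h; apply: le_trans h; rewrite ?mulrDr ?mulr1; nra.
have := K_nincr sx; rewrite s0 orbT => /(_ isT) /le_trans; apply.
have es0 : 0 < expR s - 1 by rewrite subr_gt0 -expR0 ltr_expR.
have es := expR_ge1Dx s.
rewrite /K ler_pdivrMr //.
apply: le_trans (lnF_small _) _; first by rewrite gtr0_norm.
nra.
Qed.

Lemma herbst_neg (x : R) : x < 0 -> ln (F x) <= (expR x - 1) * m.
Proof.
have := m0; have := C0; have := eta0 => eta_gt0 C_ge0 m_ge0.
move=> x0.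
have ex0 : 0 < 1 - expR x by rewrite subr_gt0 -expR0 ltr_expR.
have ex1 : 1 - expR x <= 1 by have := expR_ge0 x; lra.
apply/ler_addgt0Pr => e e0.
have C1 : 0 < 2 * (C + 1) by lra.
pose s := Num.min 1 (Num.min (- x / 2) (Num.min eta (e / (2 * (C + 1))))).
have s0 : 0 < s by rewrite !lt_min eta0 ltr01 !divr_gt0 //; lra.
have s1 : s <= 1 by rewrite !ge_min lexx.
have sx : s < - x.
  by have : s <= - x / 2; [rewrite !ge_min lexx orbT|lra].
have seta : s <= eta by rewrite !ge_min lexx !orbT.
have sC : 2 * s * C <= e.
  have : s <= e / (2 * (C + 1)) by rewrite !ge_min lexx !orbT.
  by rewrite ler_pdivlMr // => h; apply: le_trans h; rewrite ?mulrDr ?mulr1; nra.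
(* For x < 0 the comparison point is - s, on the same side of 0. *)
have Kx : K (- s) <= K x.
  by apply: K_nincr; [lra|rewrite oppr_lt0 s0].
have es0 : 0 < 1 - expR (- s) by rewrite subr_gt0 -expR0 ltr_expR oppr_lt0.
have es := expR_ge1Dx (- s).
have es2 : s / 2 <= 1 - expR (- s).
  rewrite expRN; have e1 := expR_ge1Dx s.
  have : (expR s)^-1 <= (1 + s)^-1 by rewrite lef_pV2 ?posrE ?expR_gt0 //; lra.
  have : (1 + s)^-1 <= 1 - s / 2.
    rewrite -[X in X <= _]mul1r ler_pdivrMr; nra.
  lra.
have l1 : ln (F (- s)) <= - s * m + s ^+ 2 * C.
  by have := lnF_small (x := - s); rewrite normrN gtr0_norm // sqrrN; apply.
have KE y : y != 0 -> ln (F y) = K y * (expR y - 1).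
  by move=> y0; rewrite /K divfK ?expR1_neq0.
have Es := KE (- s); have Ex := KE x.
rewrite Ex ?lt_eqF //; rewrite Es ?oppr_eq0 ?gt_eqF // in l1.
have Ks : m - 2 * s * C <= K (- s).
  have : s * m - s ^+ 2 * C <= K (- s) * (1 - expR (- s)) by lra.
  move=> h; rewrite -(ler_pM2r es0); apply: le_trans h.
  set q := 1 - expR (- s) in es0 es2 *.
  have qs : q <= s by rewrite /q; lra.
  have h1 : 0 <= m * (s - q) by rewrite mulr_ge0 // subr_ge0.
  have h2 : 0 <= s * C * (q - s / 2).
    by rewrite mulr_ge0 ?subr_ge0 // mulr_ge0 // ltW.
  lra.
have : m - 2 * s * C <= K x by exact: le_trans Ks Kx.
nra.
Qed.

Lemma herbst (x : R) : F x <= expR ((expR x - 1) * m).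
Proof.
rewrite -[X in X <= _](lnK (F_gt0 x)) ler_expR.
have [x0|x0|->] := ltgtP x 0; [exact: herbst_neg|exact: herbst_pos|].
have := @lnF_small 0; rewrite normr0 expR0 subrr !mul0r expr0n mul0r addr0.
by apply; exact: ltW.
Qed.

End herbst.

(** * Configuration functions *)

Section configuration.
Context (R : realType) (d : measure_display) (V : measurableType d) (n : nat).

(** Q t J is to be read as: the coordinates of t with index in J form an
admissible configuration. *)
Definition config_size (Q : n.-tuple V -> {set 'I_n} -> bool) (t : n.-tuple V) : nat :=
  \max_(J : {set 'I_n} | Q t J) #|J|.

Definition config_without (Q : n.-tuple V -> {set 'I_n} -> bool) (i : 'I_n)
    (t : n.-tuple V) (J : {set 'I_n}) : bool :=
  Q t J && (i \notin J).

Implicit Types Q : n.-tuple V -> {set 'I_n} -> bool.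

Lemma config_size_le Q t : (config_size Q t <= n)%N.
Proof.
by apply/bigmax_leqP => J _; rewrite (leq_trans (max_card _)) // card_ord.
Qed.

Lemma measurable_gt_config_size Q (k : nat) :
  (forall J, measurable [set t | Q t J]) ->
  measurable [set t | (k < config_size Q t)%N].
Proof.
move=> mQ.
rewrite (_ : [set t | _] =
  \bigcup_(J in [set J : {set 'I_n} | (k < #|J|)%N]) [set t | Q t J]).
  by apply: fin_bigcup_measurable => // J _; exact: mQ.
apply/seteqP; split => t /=.
  rewrite ltnNge => /negP kZ; apply: contrapT => nJ; apply: kZ.
  apply/bigmax_leqP => J QJ; rewrite leqNgt; apply/negP => kJ.
  by apply: nJ; exists J.
by move=> [J /= kJ QJ]; apply: (leq_trans kJ); exact: leq_bigmax_cond.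
Qed.

(** The size is bounded by n, hence a sum of indicators of its superlevel
sets. *)
Lemma measurable_config_size Q : (forall J, measurable [set t | Q t J]) ->
  measurable_fun setT (fun t => (config_size Q t)%:R : R).
Proof.
move=> mQ.
rewrite (_ : (fun t => _) =
  (fun t => \sum_(k < n) \1_[set t | (k < config_size Q t)%N] t)).
  apply: measurable_sum => k; apply: measurable_indic.
  exact: measurable_gt_config_size.
apply/funext => t.
transitivity (\sum_(k < n) (k < config_size Q t)%N%:R : R); last first.
  apply: eq_bigr => k _; rewrite indicE; congr (nat_of_bool _)%:R.
  by apply/idP/idP; rewrite inE.
rewrite -natr_sum; congr (_%:R).
have /minn_idPr := config_size_le Q t; move: (config_size Q t) => z {1}<-.
by elim: n => [|m IH]; rewrite ?big_ord0 ?big_ord_recr /= -?IH; lia.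
Qed.

Section size_drop.
Context (Q : n.-tuple V -> {set 'I_n} -> bool).
Hypotheses (Q0 : forall t, Q t finset.set0)
  (QS : forall t (J K : {set 'I_n}), K \subset J -> Q t J -> Q t K)
  (Qlocal : forall t t' (J : {set 'I_n}),
     (forall i, i \in J -> tnth t i = tnth t' i) -> Q t J -> Q t' J).

Let Z := config_size Q.
Let Zi i := config_size (config_without Q i).

Lemma config_size_attained t : exists2 J : {set 'I_n}, Q t J & #|J| = Z t.
Proof.
have [|J QJ E] := @eq_bigmax_cond _ (fun J => Q t J) (fun J : {set 'I_n} => #|J|).
  by apply/card_gt0P; exists finset.set0; exact: Q0.
by exists J => //; rewrite /Z /config_size E.
Qed.

Lemma config_without_le i t : (Zi i t <= Z t)%N.
Proof.
by apply/bigmax_leqP => J /andP[QJ _]; exact: leq_bigmax_cond.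
Qed.

Lemma config_without_ge i t (J : {set 'I_n}) : Q t J ->
  (#|J| - (i \in J) <= Zi i t)%N.
Proof.
move=> QJ; rewrite [#|J|](cardsD1 i) addKn.
apply: leq_bigmax_cond; rewrite /config_without !inE eqxx andbT.
by apply: QS QJ; exact: finset.subsetDl.
Qed.

Lemma config_size_drop_le1 i t : (Z t <= (Zi i t).+1)%N.
Proof.
have [J QJ <-] := config_size_attained t.
by have := config_without_ge i QJ; case: (i \in J) => /=; lia.
Qed.

(** Deleting an index outside a largest admissible J leaves J admissible, so
only the elements of J contribute, each by at most 1. *)
Lemma sum_config_drop_le t : (\sum_(i < n) (Z t - Zi i t) <= Z t)%N.
Proof.
have [J QJ JZ] := config_size_attained t.
rewrite -[leqRHS]JZ -sum1_card [leqRHS]big_mkcond; apply: leq_sum => i _.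
by have := config_without_ge i QJ; rewrite -JZ; case: (i \in J) => /=; lia.
Qed.

Lemma config_without_local i t v : Zi i (resample i t v) = Zi i t.
Proof.
apply: eq_bigl => J; rewrite /config_without.
have [iJ|iJ] := boolP (i \in J); rewrite ?andbF ?andbT //.
have E k : k \in J -> tnth (resample i t v) k = tnth t k.
  rewrite tnth_resample; case: eqP => // /val_inj ->; by rewrite (negbTE iJ).
by apply/idP/idP; apply: Qlocal => k kJ; rewrite E.
Qed.

Lemma measurable_config_without i : (forall J, measurable [set t | Q t J]) ->
  forall J, measurable [set t | config_without Q i t J].
Proof.
move=> mQ J; rewrite /config_without; case: (i \notin J).
  by under eq_set do rewrite andbT; exact: mQ.
rewrite (_ : [set t | _] = set0); first exact: measurable0.
by apply/seteqP; split => t //=; rewrite andbF.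
Qed.

End size_drop.

End configuration.

(** * Exponential moments of configuration functions *)

Lemma expR_le_quadratic (R : realType) (y : R) : y <= 1 / 2 ->
  expR y <= 1 + y + 2 * y ^+ 2.
Proof.
move=> y2.
have h : 0 < 1 - y by lra.
have := expR_ge1Dx (- y).
rewrite expRN => e1.
have : expR y <= (1 - y)^-1.
  by rewrite -[expR y]invrK lef_pV2 ?posrE ?invr_gt0 ?expR_gt0.
move/le_trans; apply.
rewrite -[X in X <= _]mul1r ler_pdivrMr // -subr_ge0.
rewrite (_ : _ - _ = y ^+ 2 * (1 - 2 * y)); last by ring.
by rewrite mulr_ge0 ?sqr_ge0 //; lra.
Qed.

Section configuration_mgf.
Context (R : realType) (d : measure_display) (V : measurableType d) (n : nat).
Context (mu : probability V R).
Context (rho : probability (n.-tuple V) R) (rhoP : iid_law mu rho).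
Context (Q : n.-tuple V -> {set 'I_n} -> bool).
Hypotheses (Q0 : forall t, Q t finset.set0)
  (QS : forall t (J K : {set 'I_n}), K \subset J -> Q t J -> Q t K)
  (Qlocal : forall t t' (J : {set 'I_n}),
     (forall i, i \in J -> tnth t i = tnth t' i) -> Q t J -> Q t' J)
  (mQ : forall J, measurable [set t | Q t J]).

Let Z := config_size Q.
Let Zi i := config_size (config_without Q i).

Let p (k : nat) : R := \int[rho]_t (Z t == k)%:R.

Let bZk (k : nat) : bounded_measurable (fun t => (Z t == k)%:R : R).
Proof.
apply: (@bmeas_itv _ _ _ _ 0 1); last by move=> t; case: eqP => _; rewrite lexx ler01.
rewrite (_ : (fun _ => _) = \1_[set t | (Z t)%:R = k%:R :> R]).
  apply: measurable_indic.
  have := measurable_config_size mQ measurableT (measurable_set1 (k%:R : R)).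
  by rewrite setTI.
apply/funext => t; rewrite indicE; congr (nat_of_bool _)%:R.
apply/idP/idP => [/eqP E|]; rewrite inE /=; first by rewrite E.
by move/eqP; rewrite eqr_nat.
Qed.

(** As Z takes finitely many values, means of functions of Z are finite sums,
which can be differentiated term by term. *)
Let config_fun_sum (h : nat -> R) t : h (Z t) = \sum_(k < n.+1) h k * (Z t == k)%:R.
Proof.
have Zn : (Z t < n.+1)%N by rewrite ltnS config_size_le.
rewrite (bigD1 (Ordinal Zn)) //= eqxx mulr1 big1 ?addr0 // => k.
by rewrite -val_eqE /= eq_sym => /negbTE ->; rewrite mulr0.
Qed.

Let bhZk (h : nat -> R) (k : nat) : bounded_measurable (fun t => h k * (Z t == k)%:R).
Proof. by apply: bmeasM; [exact: bmeas_cst|exact: bZk]. Qed.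

Lemma bmeas_config_fun (h : nat -> R) : bounded_measurable (fun t => h (Z t)).
Proof.
rewrite (_ : (fun t => _) = (fun t => \sum_(k < n.+1) h k * (Z t == k)%:R)).
  by apply: bmeas_sum => k; exact: bhZk.
by apply/funext => t; exact: config_fun_sum.
Qed.

Let mean_config_fun (h : nat -> R) :
  \int[rho]_t h (Z t) = \sum_(k < n.+1) h k * p k.
Proof.
transitivity (\int[rho]_t \sum_(k < n.+1) h k * (Z t == k)%:R).
  by apply: eq_Rintegral => t _; exact: config_fun_sum.
rewrite bmean_sum; last by move=> k; exact: bhZk.
by apply: eq_bigr => k _; rewrite bmeanZ //; exact: bZk.
Qed.

Let F (x : R) : R := \int[rho]_t expR (x * (Z t)%:R).
Let dF (x : R) : R := \int[rho]_t ((Z t)%:R * expR (x * (Z t)%:R)).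
Let m : R := \int[rho]_t (Z t)%:R.

Let Z_le t : (Z t)%:R <= n%:R :> R.
Proof. by rewrite ler_nat config_size_le. Qed.

Let bF (x : R) : bounded_measurable (fun t => expR (x * (Z t)%:R)).
Proof. exact: (bmeas_config_fun (fun k => expR (x * k%:R))). Qed.

Let bm : bounded_measurable (fun t => (Z t)%:R : R).
Proof. exact: (bmeas_config_fun (fun k => k%:R)). Qed.

Let F_gt0 (x : R) : 0 < F x.
Proof.
have bound t : expR (- (`|x| * n%:R)) <= expR (x * (Z t)%:R) <= expR (`|x| * n%:R).
  rewrite !ler_expR -ler_norml normrM ler_wpM2l //.
  by rewrite normr_nat.
have [mF _] := bF x.
have /andP[h _] := bmean_itv rho mF bound.
exact: lt_le_trans (expR_gt0 _) h.
Qed.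

Let F_derive (x : R) : is_derive x 1 F (dF x).
Proof.
pose h (k : 'I_n.+1) := fun y : R => expR (y * k%:R) * p k.
have -> : F = \sum_(k < n.+1) h k.
  apply/funext => y; rewrite fct_sumE /F.
  by rewrite (mean_config_fun (fun k => expR (y * k%:R))).
rewrite /dF (mean_config_fun (fun k => k%:R * expR (x * k%:R))).
apply: is_derive_sum => k.
have d1 : is_derive x 1 (fun y : R => y * k%:R) k%:R.
  have := is_deriveM (is_derive_id x (1 : R)) (is_derive_cst (k%:R : R) x 1).
  by rewrite scaler0 add0r /GRing.scale /= mulr1.
have d2 : is_derive x 1 (fun y : R => expR (y * k%:R)) (expR (x * k%:R) * k%:R).
  exact: is_derive1_comp (is_derive_expR _) d1.
have := is_deriveM d2 (is_derive_cst (p k) x 1).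
rewrite scaler0 add0r (_ : _ *: _ = k%:R * expR (x * k%:R) * p k) //.
by rewrite /GRing.scale /=; ring.
Qed.

Let m_ge0 : 0 <= m.
Proof. by apply: Rintegral_ge0 => t _; exact: ler0n. Qed.

Let F_small (x : R) : `|x| <= (2 * n.+1%:R)^-1 ->
  F x <= 1 + x * m + x ^+ 2 * (2 * n%:R ^+ 2).
Proof.
move=> xn.
have -> : 1 + x * m + x ^+ 2 * (2 * n%:R ^+ 2) =
    \int[rho]_t (1 + x * (Z t)%:R + x ^+ 2 * (2 * n%:R ^+ 2)).
  have bx : bounded_measurable (fun t => x * (Z t)%:R).
    by apply: bmeasM => //; exact: bmeas_cst.
  rewrite bmeanD; [|by apply: bmeasD => //; exact: bmeas_cst|exact: bmeas_cst].
  rewrite bmeanD //; last exact: bmeas_cst.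
  by rewrite bmeanZ // (bmean_cst _ 1) (bmean_cst _ (_ * _)).
apply: bmean_le => //.
  apply: bmeasD; last exact: bmeas_cst.
  apply: bmeasD; first exact: bmeas_cst.
  by apply: bmeasM => //; exact: bmeas_cst.
move=> t; have zn := Z_le t; have z0 : 0 <= (Z t)%:R :> R := ler0n _ _.
set z : R := (Z t)%:R in zn z0 *.
have n0 : 0 < n.+1%:R :> R by rewrite ltr0n.
have xz : x * z <= 1 / 2.
  apply: le_trans (ler_norm _) _; rewrite normrM (ger0_norm z0).
  apply: (@le_trans _ _ ((2 * n.+1%:R)^-1 * n.+1%:R)).
    by apply: ler_pM => //; apply: le_trans zn _; rewrite ler_nat.
  by rewrite invfM -mulrA mulVf ?gt_eqF // mulr1 div1r.
apply: le_trans (expR_le_quadratic xz) _; rewrite lerD2l exprMn mulrCA.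
by rewrite ler_wpM2l ?sqr_ge0 // ler_wpM2l // lerXn2r // nnegrE.
Qed.

(** Entropy is subadditive; for f = exp (x Z) and u_i = exp (x Z_i), where Z_i
is the size without index i, the difference Z - Z_i is 0 or 1, so that the
i-th term equals c f (Z - Z_i) with c = exp (- x) + x - 1.  The drops add up to
at most Z. *)
Let F_ineq (x : R) : (1 - expR (- x)) * dF x <= F x * ln (F x).
Proof.
pose f t := expR (x * (Z t)%:R); pose u i t := expR (x * (Zi i t)%:R).
pose a := expR (- (`|x| * n%:R)); pose b := expR (`|x| * n%:R).
have bound (z : nat) : (z <= n)%N -> a <= expR (x * z%:R) <= b.
  move=> zn; rewrite !ler_expR -ler_norml normrM ler_wpM2l //.
  by rewrite normr_nat ler_nat.
have a0 : 0 < a by exact: expR_gt0.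
have mf : measurable_fun setT f by have [] := bF x.
have mu_ i : measurable_fun setT (u i).
  apply: (measurableT_comp (@measurable_expR R)).
  apply: measurable_funM => //.
  by apply: measurable_config_size; exact: measurable_config_without.
have bf : bounded_measurable f := bF x.
have bu i : bounded_measurable (u i).
  by apply: (@bmeas_itv _ _ _ _ a b) => // t; apply/bound/config_size_le.
have bf' : bounded_measurable (fun t => (Z t)%:R * f t).
  exact: (bmeas_config_fun (fun k => k%:R * expR (x * k%:R))).
have bZi i : bounded_measurable (fun t => (Zi i t)%:R : R).
  apply: (@bmeas_itv _ _ _ _ 0 n%:R); last by move=> t; rewrite ler0n ler_nat config_size_le.
  by apply: measurable_config_size; exact: measurable_config_without.
have := @entropy_subadditive _ _ _ _ _ _ rhoP f a b a0 mf _ u mu_.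
move=> /(_ (fun t => bound _ (config_size_le Q t))).
move=> /(_ (fun i t => bound _ (config_size_le (config_without Q i) t))).
have ul i t v : u i (resample i t v) = u i t.
  by rewrite /u /Zi (config_without_local Qlocal).
move=> /(_ ul).
have -> : \int[rho]_t (f t * ln (f t)) = x * dF x.
  rewrite -bmeanZ //; apply: eq_Rintegral => t _.
  by rewrite /f expRK; ring.
set E := \int[rho]_t f t; rewrite -/(F x) in E *.
set c := expR (- x) + x - 1.
have c0 : 0 <= c by have := expR_ge1Dx (- x); rewrite /c; lra.
move=> ent.
suff : \sum_(i < n) \int[rho]_t (f t * (ln (f t) - ln (u i t)) - f t + u i t) <= c * dF x.
  by move=> h; have := le_trans ent h; rewrite /c /E -/(F x); lra.
have bterm i : bounded_measurable (fun t => f t * (ln (f t) - ln (u i t)) - f t + u i t).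
  apply: bmeasD => //; apply: bmeasB => //; apply: bmeasM => //.
  rewrite (_ : (fun _ => _) = (fun t => x * (Z t)%:R - x * (Zi i t)%:R)).
    by apply: bmeasB; apply: bmeasM => //; exact: bmeas_cst.
  by apply/funext => t; rewrite !expRK.
rewrite -bmean_sum // -bmeanZ //; apply: bmean_le.
- exact: bmeas_sum.
- by apply: bmeasM => //; exact: bmeas_cst.
move=> t.
have f0 : 0 < f t by exact: expR_gt0.
have -> : \sum_(i < n) (f t * (ln (f t) - ln (u i t)) - f t + u i t) =
   c * f t * (\sum_(i < n) (Z t - Zi i t)%N)%:R.
  rewrite natr_sum mulr_sumr; apply: eq_bigr => i _; rewrite !expRK.
  have le1 := config_without_le Q i t; have ge1 := config_size_drop_le1 Q0 QS i t.
  rewrite -/(Z t) -/(Zi i t) in le1 ge1.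
  have [E0|E1] : (Z t = Zi i t \/ Z t = (Zi i t).+1)%N by lia.
    by rewrite /u -E0 /f subnn; ring.
  have -> : (Z t - Zi i t = 1)%N by lia.
  have -> : u i t = f t * expR (- x).
    by rewrite /u /f -expRD E1 -natr1; congr expR; ring.
  by rewrite /c E1 -natr1; ring.
rewrite (_ : c * ((Z t)%:R * f t) = c * f t * (Z t)%:R); last by ring.
apply: ler_wpM2l; first by rewrite mulr_ge0 // ltW.
by rewrite ler_nat; exact: sum_config_drop_le.
Qed.

Lemma config_mgf_le (x : R) :
  \int[rho]_t expR (x * (config_size Q t)%:R) <=
  expR ((expR x - 1) * \int[rho]_t (config_size Q t)%:R).
Proof.
apply: (herbst F_gt0 F_derive F_ineq m_ge0 _ _ F_small).
- by rewrite mulr_ge0 // sqr_ge0.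
- by rewrite invr_gt0 mulr_gt0.
Qed.

End configuration_mgf.

(** * Concentration of configuration functions *)

(** The difference h vanishes at 0, and its derivative on [0, 1/2] is at most 0
by bounds of lower order on the exponential; the sign s treats both
exponentials at once. *)
Lemma expR_le_cubic (R : realType) (x : R) : 0 <= x <= 1 / 2 ->
  expR x <= 1 + x + x ^+ 2 / 2 * (1 + 4 / 3 * x) /\
  expR (- x) <= 1 - x + x ^+ 2 / 2 * (1 + 4 / 3 * x).
Proof.
move=> /andP[x0 x1]; have [->|xn0] := eqVneq x 0.
  by rewrite oppr0 expR0; split; lra.
have {xn0} x0' : 0 < x by rewrite lt_def xn0.
have main (s : R) (s1 : `|s| = 1) :
    expR (s * x) <= 1 + s * x + x ^+ 2 / 2 * (1 + 4 / 3 * x).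
  pose h y : R := expR (s * y) - (1 + s * y + y ^+ 2 / 2 * (1 + 4 / 3 * y)).
  pose dh y : R := s * expR (s * y) - (s + y + 2 * y ^+ 2).
  have hd (y : R) : is_derive y 1 h (dh y).
    pose p : {poly R} := (1 + s *: 'X + 2^-1 *: 'X^2 + (2 / 3) *: 'X^3).
    have d1 : is_derive y 1 (fun z : R => s * z) s.
      have := is_deriveM (is_derive_cst (s : R) y 1) (is_derive_id y (1 : R)).
      by rewrite scaler0 addr0 /GRing.scale /= mulr1.
    have d2 : is_derive y 1 (fun z : R => expR (s * z)) (expR (s * y) * s).
      exact: is_derive1_comp (is_derive_expR _) d1.
    have d3 := is_derive_poly p y.
    have E1 : h = (fun z : R => expR (s * z)) - (fun z : R => p.[z]).
      apply/funext => z; rewrite /h !fctE /p !hornerE /=; by field.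
    have E2 : dh y = expR (s * y) * s - (deriv p).[y].
      rewrite /dh /p !poly.derivE !hornerE /=; by field.
    by have := is_deriveB d2 d3; rewrite -E1 -E2.
  have [|c c0x E] := @MVT _ h dh 0 x x0' (fun y _ => hd y).
    apply: derivable_within_continuous => y _; by have [] := hd y.
  have h0 : h 0 = 0 by rewrite /h mulr0 expR0; ring.
  have c0 : 0 < c by rewrite (itvP c0x).
  have cx : c < x by rewrite (itvP c0x).
  suff : dh c <= 0.
    move=> dc; have : h x - h 0 <= 0.
      by rewrite E; apply: mulr_le0_ge0 => //; lra.
    by rewrite h0 /h; lra.
  have : s = 1 \/ s = - 1.
    have [s0|s0] := leP 0 s; first by left; rewrite -s1 ger0_norm.
    by right; rewrite -s1 ltr0_norm // opprK.
  rewrite /dh => -[->|->].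
    by have := @expR_le_quadratic _ (1 * c); lra.
  by have := expR_ge1Dx (-1 * c); have := sqr_ge0 c; lra.
split; first by have := main 1; rewrite normr1 !mul1r; apply.
by have := main (- 1); rewrite normrN1 !mulN1r; apply.
Qed.

Lemma prob_le_mean (R : realType) (d : measure_display) (T : measurableType d)
    (P : probability T R) (A : set T) (g : T -> R) :
  measurable A -> bounded_measurable g -> (forall x, 0 <= g x) ->
  (forall x, A x -> 1 <= g x) -> (P A <= (\int[P]_x g x)%:E)%E.
Proof.
move=> mA bg g0 g1; rewrite -bmean_EFin //.
rewrite -[X in (X <= _)%E]mul1e -(integral_cst P mA 1%:E).
rewrite (integral_mkcond A); apply: ge0_le_integral => //.
- by move=> x _; rewrite patchE; case: ifP => // _; rewrite lee_fin.
- by apply: (proj1 (measurable_restrictT (cst 1%:E) mA)); exact: measurable_cst.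
- by apply/measurable_EFinP; have [] := bg.
- move=> x _; rewrite patchE; case: ifP => [/set_mem Ax|_]; rewrite lee_fin //.
  exact: g1.
Qed.

Section concentration.
Context (R : realType) (d : measure_display) (V : measurableType d) (n : nat).
Context (mu : probability V R).
Context (rho : probability (n.-tuple V) R) (rhoP : iid_law mu rho).
Context (Q : n.-tuple V -> {set 'I_n} -> bool).
Hypotheses (Q0 : forall t, Q t finset.set0)
  (QS : forall t (J K : {set 'I_n}), K \subset J -> Q t J -> Q t K)
  (Qlocal : forall t t' (J : {set 'I_n}),
     (forall i, i \in J -> tnth t i = tnth t' i) -> Q t J -> Q t' J)
  (mQ : forall J, measurable [set t | Q t J]).

Let Z t : R := (config_size Q t)%:R.
Let m : R := \int[rho]_t Z t.

Let tail (s l M B : R) (A : set (n.-tuple V)) : measurable A ->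
  (forall t, A t -> s <= l * (Z t - m)) ->
  m <= M -> 0 <= expR l - 1 - l -> M * (expR l - 1 - l) - s <= B ->
  (rho A <= (expR B)%:E)%E.
Proof.
move=> mA As mM l0 B_ge.
have bg : bounded_measurable (fun t => expR (l * Z t)).
  exact: (bmeas_config_fun mQ (fun k => expR (l * k%:R))).
have bg' : bounded_measurable (fun t => expR (- s - l * m) * expR (l * Z t)).
  by apply: bmeasM => //; exact: bmeas_cst.
apply: le_trans (prob_le_mean rho mA bg' _ _) _.
- by move=> t; rewrite mulr_ge0 // expR_ge0.
- move=> t /As h; rewrite -expRD -[X in X <= _]expR0 ler_expR; lra.
rewrite lee_fin bmeanZ //.
apply: le_trans (ler_wpM2l (expR_ge0 _) (config_mgf_le rhoP Q0 QS Qlocal mQ l)) _.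
rewrite -expRD ler_expR -/m; apply: le_trans B_ge.
by have := ler_wpM2r l0 mM; lra.
Qed.

(** Chernoff's bound with exponent s / M and - s / M; this exponent is optimal
for a variable with Gaussian tails of variance M, and the last factor pays for
the cubic term of the exponential. *)
Lemma config_concentration (s M : R) : m <= M -> 0 < M -> 0 <= s <= M / 2 ->
  (rho [set t | (s < `|Z t - m|)%R] <=
   (2 * expR (- (s ^+ 2 / (2 * M) * (1 - 4 / 3 * (s / M)))))%:E)%E.
Proof.
move=> mM M0 /andP[s0 sM].
pose l := s / M.
have sE : s = l * M by rewrite /l divfK // gt_eqF.
have l0 : 0 <= l by rewrite divr_ge0 // ltW.
have l1 : l <= 1 / 2 by rewrite ler_pdivrMr //; lra.
have [e1 e2] : expR l <= 1 + l + l ^+ 2 / 2 * (1 + 4 / 3 * l) /\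
    expR (- l) <= 1 - l + l ^+ 2 / 2 * (1 + 4 / 3 * l).
  by apply: expR_le_cubic; rewrite l0.
have mZ : measurable_fun setT Z by exact: measurable_config_size.
have mZm : measurable_fun setT (fun t => Z t - m).
  by apply: measurable_funB => //; exact: measurable_cst.
pose A1 := [set t | s < Z t - m]; pose A2 := [set t | Z t - m < - s].
have mA1 : measurable A1.
  have := mZm measurableT _ (measurable_itv `]s, +oo[).
  rewrite setTI (_ : _ @^-1` _ = A1) //; apply/seteqP; split=> t; rewrite /A1 /= in_itv /= andbT //.
have mA2 : measurable A2.
  have := mZm measurableT _ (measurable_itv `]-oo, (- s)[).
  rewrite setTI (_ : _ @^-1` _ = A2) //; apply/seteqP; split=> t; rewrite /A2 /= in_itv /= //.
have -> : [set t | s < `|Z t - m|] = A1 `|` A2.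
  apply/seteqP; split=> t; rewrite /A1 /A2 /= lter_normr.
    by move=> /orP[|h]; [left|right; rewrite ltrNr].
  by case=> h; apply/orP; [left|right; rewrite ltrNr].
apply: le_trans (measureU2 _ mA1 mA2) _.
rewrite mulr_natl mulr2n EFinD; apply: leeD.
  apply: (@tail (l * s) l M) => //.
  - by move=> t /ltW h; rewrite ler_wpM2l.
  - by have := expR_ge1Dx l; lra.
  rewrite -/l sE; have := ler_wpM2l (ltW M0) e1.
  rewrite (_ : (l * M) ^+ 2 / (2 * M) = l ^+ 2 * M / 2); last by field; rewrite gt_eqF.
  lra.
apply: (@tail (l * s) (- l) M) => //.
- by move=> t h; rewrite mulNr -mulrN ler_wpM2l //; move: h; rewrite /A2 /=; lra.
- by have := expR_ge1Dx (- l); lra.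
rewrite -/l sE; have := ler_wpM2l (ltW M0) e2.
rewrite (_ : (l * M) ^+ 2 / (2 * M) = l ^+ 2 * M / 2); last by field; rewrite gt_eqF.
lra.
Qed.

End concentration.

(** * Convex hulls and extreme points *)

Section hull.
Context (R : realType) (E : lmodType R).
Implicit Types (A C : set E) (x a b : E) (t : R).

(** The weight ranges over the field instead of the type of numbers in [0, 1],
which makes it accessible to arithmetic. *)
Definition convex_stable C : Prop := forall a b t, 0 <= t <= 1 ->
  C a -> C b -> C (t *: a + (1 - t) *: b).

Lemma convex_setP C : convex_set C <-> convex_stable C.
Proof.
split=> [cC a b t /andP[t0 t1] Ca Cb|cC a b l /set_mem Ca /set_mem Cb].
  by have := cC a b (Itv01 t0 t1) (mem_set Ca) (mem_set Cb) => /set_mem.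
by apply/mem_set; apply: (cC a b l%:num) => //; apply/andP; split.
Qed.

Lemma convex_hull_stable A : convex_stable (convex_hull A).
Proof.
move=> a b t t01 Ca Cb B [/= cB AB]; move/convex_setP : (cB) => cB'.
by apply: cB' => //; [apply: Ca|apply: Cb].
Qed.

Lemma sub_convex_hull A : A `<=` convex_hull A.
Proof. exact: sub_gen_smallest. Qed.

Lemma convex_hull_min A C : convex_stable C -> A `<=` C -> convex_hull A `<=` C.
Proof. by move=> cC AC; apply: smallest_sub => //; apply/convex_setP. Qed.

Lemma convex_hullS A C : A `<=` C -> convex_hull A `<=` convex_hull C.
Proof.
move=> AC; apply: convex_hull_min; first exact: convex_hull_stable.
by apply: subset_trans AC _; exact: sub_convex_hull.
Qed.

Lemma extreme_pointsP C x : extreme_points C x <->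
  C x /\ forall a b t, C a -> C b -> 0 < t < 1 -> x = t *: a + (1 - t) *: b ->
    a = x /\ b = x.
Proof.
split=> -[Cx ex]; split=> // a b t Ca Cb t01.
  have /andP[t0 t1] := t01.
  exact: (ex a b (Itv01 (ltW t0) (ltW t1))).
exact: (ex a b t%:num).
Qed.

(** Removing an extreme point from a convex set leaves a convex set. *)
Lemma extreme_convex_hull_sub A : extreme_points (convex_hull A) `<=` A.
Proof.
move=> x /extreme_pointsP[hx ex]; apply: contrapT => Ax.
suff : convex_hull A `<=` [set y | convex_hull A y /\ y <> x].
  by move=> /(_ x hx) [].
apply: convex_hull_min => [a b t /andP[t0 t1] [ha ax] [hb bx]|y Ay]; last first.
  by split; [exact: sub_convex_hull|move=> yx; apply: Ax; rewrite -yx].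
split; first by apply: convex_hull_stable => //; rewrite t0.
move: t0 t1; rewrite le_eqVlt => /predU1P[<-|t0].
  by rewrite scale0r add0r subr0 scale1r.
rewrite le_eqVlt => /predU1P[->|t1].
  by rewrite subrr scale0r addr0 scale1r.
by move=> /esym xE; apply: ax; have [|->] := ex a b t ha hb _ xE; rewrite ?t0.
Qed.

End hull.

Section chain.
Context (R : realType) (p0 p2 : plane R).
Implicit Type Y : {fset plane R}.

(** Extreme points of the hull lie among the points of Y, p0 and p2.  There can
be |Y| + 2 of them only if these points are all distinct and all extreme. *)
Lemma convex_chainP Y : convex_chain p0 p2 Y <->
  [/\ p0 != p2, p0 \notin Y, p2 \notin Y &
      [set` Y] `|` [set p0; p2] `<=`
        extreme_points (convex_hull ([set` Y] `|` [set p0; p2]))].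
Proof.
pose F := (p0 |` (p2 |` Y))%fset.
have FE : [set` Y] `|` [set p0; p2] = [set` F].
  apply/seteqP; split=> y /=; rewrite !in_fset1U.
    by case=> [->|[->|->]]; rewrite ?eqxx ?orbT.
  by move=> /or3P[/eqP|/eqP|]; [right; left|right; right|left].
rewrite /convex_chain FE; set ext := extreme_points _.
have extF : ext `<=` [set` F] by exact: extreme_convex_hull_sub.
have cF : #|` F| = ((p0 \notin (p2 |` Y)%fset) + ((p2 \notin Y) + #|` Y|))%N.
  by rewrite !cardfsU1.
split=> [cext|[p02 p0Y p2Y Fext]]; last first.
  have -> : ext = [set` F] by apply/seteqP.
  apply/card_eq_fsetP; rewrite cF in_fset1U negb_or p02 p0Y p2Y /=.
  by lia.
have fext : finite_set ext by apply/finite_setP; exists (#|` Y| + 2)%N.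
have cE := card_fset_set cext.
have sF : (fset_set ext `<=` F)%fset.
  by rewrite -[F]set_fsetK -fset_set_sub.
have le2 := fsubset_leq_card sF; rewrite cE cF in le2.
have : (p0 \notin (p2 |` Y)%fset) && (p2 \notin Y).
  by move: le2; case: (p0 \notin _); case: (p2 \notin Y) => //=; lia.
rewrite in_fset1U negb_or => /andP[/andP[p02 p0Y] p2Y]; split=> //.
have : fset_set ext = F.
  apply/eqP; rewrite eqEfcard sF /= cE cF in_fset1U negb_or p02 p0Y p2Y /=.
  by lia.
by move=> <-; rewrite fset_setK.
Qed.

End chain.

(** * Separation in the plane *)

(** Finitely many strict inequalities survive a small perturbation. *)
Lemma perturb_gt0 (R : realType) (T : eqType) (s : seq T) (p q : T -> R) :
  (forall x, x \in s -> 0 < p x) ->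
  exists2 e, 0 < e & forall c, `|c| < e -> forall x, x \in s -> 0 < p x + c * q x.
Proof.
elim: s => [|x s IH] ps; first by exists 1.
have [|e e0 es] := IH; first by move=> y ys; apply: ps; rewrite in_cons ys orbT.
have px : 0 < p x by apply: ps; rewrite mem_head.
have qx : 0 < `|q x| + 1 by have := normr_ge0 (q x); lra.
exists (Num.min e (p x / (`|q x| + 1))) => [|c]; first by rewrite lt_min e0 divr_gt0.
rewrite lt_min => /andP[ce]; rewrite ltr_pdivlMr // => cp y.
rewrite in_cons => /predU1P[->|]; last exact: es.
have := ler_norm (- (c * q x)); rewrite normrN normrM.
have := normr_ge0 c; lra.
Qed.

Section separation.
Context (R : realType).
Implicit Types (s : seq (plane R)) (u v w z : plane R) (a b : R).

Definition lin a b v : R := a * v.1 + b * v.2.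

Definition det u v : R := u.1 * v.2 - u.2 * v.1.

Lemma linB a b u v : lin a b (u - v) = lin a b u - lin a b v.
Proof. by rewrite /lin /=; ring. Qed.

Lemma linD a b u v : lin a b (u + v) = lin a b u + lin a b v.
Proof. by rewrite /lin /=; ring. Qed.

Lemma linZ a b (c : R) v : lin a b (c *: v) = c * lin a b v.
Proof. by rewrite /lin /= /GRing.scale /=; ring. Qed.

Lemma rational_lin s a b : (forall v, v \in s -> 0 < lin a b v) ->
  exists q : rat * rat, forall v, v \in s -> 0 < lin (ratr q.1) (ratr q.2) v.
Proof.
have ratr_near (x e : R) : 0 < e -> exists q : rat, `|ratr q - x| < e.
  move=> e0; have /rat_in_itvoo[q] : x < x + e by lra.
  rewrite in_itv /= => /andP[q1 q2]; exists q; rewrite ltr_norml; lra.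
move=> s0.
have [e1 e10 h1] := perturb_gt0 (fun v => v.1 : R) s0.
have [q1 /h1 {}h1] := ratr_near a e1 e10.
have [e2 e20 h2] := perturb_gt0 (fun v => v.2 : R) h1.
have [q2 /h2 {}h2] := ratr_near b e2 e20.
exists (q1, q2) => v /h2 /=.
by rewrite /lin; congr (0 < _); ring.
Qed.

Lemma convex_hull_comb2 (A : set (plane R)) u v (x y : R) :
  convex_hull A u -> convex_hull A v -> 0 <= x -> 0 <= y -> 0 < x + y ->
  x *: u + y *: v = 0 -> convex_hull A 0.
Proof.
move=> hu hv x0 y0 xy0 E.
have n0 : x + y != 0 by rewrite gt_eqF.
have -> : 0 = (x / (x + y)) *: u + (1 - x / (x + y)) *: v.
  rewrite (_ : 1 - _ = y / (x + y)); last by field.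
  by rewrite ![_ / _]mulrC -!scalerA -scalerDr E scaler0.
apply: convex_hull_stable => //; rewrite divr_ge0 ?(ltW xy0) //=.
by rewrite ler_pdivrMr // mul1r lerDl.
Qed.

Lemma convex_hull_comb3 (A : set (plane R)) u v w (x y z : R) :
  convex_hull A u -> convex_hull A v -> convex_hull A w ->
  0 < x -> 0 <= y -> 0 <= z ->
  x *: u + y *: v + z *: w = 0 -> convex_hull A 0.
Proof.
move=> hu hv hw x0 y0 z0 E.
have xy0 : 0 < x + y by lra.
have n0 : x + y != 0 by rewrite gt_eqF.
pose u' := (x / (x + y)) *: u + (1 - x / (x + y)) *: v.
have hu' : convex_hull A u'.
  apply: convex_hull_stable => //; rewrite divr_ge0 ?(ltW xy0) ?(ltW x0) //=.
  by rewrite ler_pdivrMr // mul1r lerDl.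
apply: (@convex_hull_comb2 A u' w (x + y) z) => //; [lra|lra|].
rewrite /u' (_ : 1 - _ = y / (x + y)); last by field.
rewrite scalerDr !scalerA ![(x + y) * (_ / _)]mulrC !divfK // -E.
Qed.

(** Induction on the list.  Let l be positive on s but negative at the new
vector f.  If the determinants det f h, for h in s, have one strict sign, then
the functional det f is, up to sign, positive on s and zero at f, and a slight
tilt towards f is positive on both.  Otherwise some h is a negative multiple of
f, or two members of s lie strictly on either side of the line of f, and 0 is a
positive combination of at most three vectors. *)
Lemma gordan s : (exists a b, forall v, v \in s -> 0 < lin a b v) \/
  convex_hull [set` s] 0.
Proof.
elim: s => [|f s [[a [b sab]]|h0]]; first by left; exists 0, 0.
have hs v : v \in f :: s -> convex_hull [set` f :: s] v.
  by move=> vs; apply: sub_convex_hull.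
have hf : convex_hull [set` f :: s] f by apply: hs; rewrite mem_head.
have hss v : v \in s -> convex_hull [set` f :: s] v.
  by move=> vs; apply: hs; rewrite in_cons vs orbT.
have [f0|f0] := eqVneq f 0; first by right; rewrite -[0]f0.
have ff0 : 0 < lin f.1 f.2 f.
  rewrite /lin -!expr2 lt_def addr_ge0 ?sqr_ge0 // andbT paddr_eq0 ?sqr_ge0 //.
  by rewrite !sqrf_eq0; apply: contra f0 => /andP[/eqP f1 /eqP f2]; apply/eqP/injective_projections.
have extend (a' b' : R) : 0 <= lin a' b' f -> (forall v, v \in s -> 0 < lin a' b' v) ->
    exists a b, forall v, v \in f :: s -> 0 < lin a b v.
  move=> lf ls.
  have [e e0 he] := perturb_gt0 (lin f.1 f.2) ls.
  have e2 : 0 < e / 2 by lra.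
  exists (a' + e / 2 * f.1), (b' + e / 2 * f.2) => v.
  have -> : lin (a' + e / 2 * f.1) (b' + e / 2 * f.2) v =
     lin a' b' v + e / 2 * lin f.1 f.2 v by rewrite /lin; ring.
  rewrite in_cons => /predU1P[->|]; last by apply: he; rewrite gtr0_norm //; lra.
  by have := mulr_gt0 e2 ff0; lra.
have [lf|lf] := leP 0 (lin a b f); first by left; exact: (extend a b).
have [/hasP[h hs0 /eqP dh]|/hasPn dn0] := boolP (has (fun h => det f h == 0) s).
  right; apply: (@convex_hull_comb2 _ f h (lin a b h) (- lin a b f)) => //.
  - exact: hss.
  - by rewrite ltW // sab.
  - by rewrite oppr_ge0 ltW.
  - by have := sab _ hs0; lra.
  apply: injective_projections; rewrite /= /GRing.scale /=.
    rewrite -[RHS](mulr0 b) -dh /lin /det; ring.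
  by rewrite -[RHS](mulr0 (- a)) -dh /lin /det; ring.
have [/allP dpos|/allPn[h1 h1s h1n]] := boolP (all (fun h => 0 < det f h) s).
  left; apply: (extend (- f.2) f.1); first by rewrite /lin; lra.
  by move=> v /dpos; rewrite /det /lin; congr (0 < _); ring.
have [/allP dneg|/allPn[h2 h2s h2n]] := boolP (all (fun h => det f h < 0) s).
  left; apply: (extend f.2 (- f.1)); first by rewrite /lin; lra.
  by move=> v /dneg; rewrite -oppr_gt0 /det /lin; congr (0 < _); ring.
have d1 : det f h1 < 0 by rewrite lt_def eq_sym dn0 //= leNgt.
have d2 : 0 < det f h2 by rewrite lt_def dn0 //= leNgt.
have l1 := sab _ h1s; have l2 := sab _ h2s.
have cramer (c e : R) : lin c e (det h2 h1 *: f) + lin c e (det f h2 *: h1)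
    + lin c e (- det f h1 *: h2) = 0.
  by rewrite /lin /det /= /GRing.scale /=; ring.
right; apply: (@convex_hull_comb3 _ f h1 h2 (det h2 h1) (det f h2) (- det f h1)).
- by [].
- exact: hss.
- exact: hss.
- have := cramer a b; rewrite !linZ => E; rewrite -(nmulr_llt0 _ lf).
  have n1 : 0 < - det f h1 by rewrite oppr_gt0.
  by have := mulr_gt0 d2 l1; have := mulr_gt0 n1 l2; lra.
- exact: ltW.
- by rewrite oppr_ge0 ltW.
- apply: injective_projections; first by rewrite -[RHS](cramer 1 0) /lin /=; ring.
  by rewrite -[RHS](cramer 0 1) /lin /=; ring.
- by right; apply: convex_hullS h0 => v /=; rewrite in_cons => ->; rewrite orbT.
Qed.

(** Rational coefficients make this a countable condition on the points, which
is what measurability needs. *)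
Lemma extreme_exposed s z : z \in s ->
  extreme_points (convex_hull [set` s]) z <->
  exists q : rat * rat, forall v, v \in s -> v != z ->
    0 < lin (ratr q.1) (ratr q.2) (v - z).
Proof.
move=> zs; split=> [/extreme_pointsP[_ ex]|[q qs]].
  pose s' := [seq v - z | v <- s & v != z].
  have [[a [b ab]]|h0] := gordan s'.
    have [q qs] := rational_lin ab; exists q => v vs vz; apply: qs.
    by apply/mapP; exists v => //; rewrite mem_filter vz.
  have hz : convex_hull ([set` s] `\ z) z.
    suff : convex_hull [set` s'] `<=` [set v | convex_hull ([set` s] `\ z) (v + z)].
      by move=> /(_ _ h0) /=; rewrite add0r.
    apply: convex_hull_min => [u v t t01 hu hv|_ /= /mapP[v + ->]].
      have := convex_hull_stable t01 hu hv; rewrite /=; congr convex_hull.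
      by rewrite !scalerDr addrACA -scalerDl addrCA subrr addr0 scale1r.
    rewrite mem_filter => /andP[/eqP vz vs]; rewrite subrK.
    by apply: sub_convex_hull; split.
  have : ([set` s] `\ z) z.
    apply: extreme_convex_hull_sub; apply/extreme_pointsP; split=> // a b t ha hb.
    by apply: ex; [move: ha|move: hb]; apply: convex_hullS; exact: subDsetl.
  by move=> [_ /(_ erefl)].
apply/extreme_pointsP; split; first exact: sub_convex_hull.
pose l v := lin (ratr q.1) (ratr q.2) (v - z).
have lpos x : convex_hull [set` s] x -> x = z \/ 0 < l x.
  suff : convex_hull [set` s] `<=` [set v | v = z \/ 0 < l v] by move=> h /h.
  apply: convex_hull_min => [u v t /andP[]|w ws /=]; last first.
    by have [|wz] := eqVneq w z; [left|right; exact: qs].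
  rewrite le_eqVlt => /predU1P[<- _ _ vP|t0].
    by rewrite scale0r add0r subr0 scale1r.
  rewrite le_eqVlt => /predU1P[-> uP _|t1].
    by rewrite subrr scale0r addr0 scale1r.
  have lE : l (t *: u + (1 - t) *: v) = t * l u + (1 - t) * l v.
    by rewrite /l !linB linD !linZ; ring.
  have lz : l z = 0 by rewrite /l subrr /lin /= !mulr0 addr0.
  have t1' : 0 < 1 - t by rewrite subr_gt0.
  rewrite /= lE => -[->|lu] [->|lv].
  - by left; rewrite -scalerDl addrCA subrr addr0 scale1r.
  - by right; rewrite lz mulr0 add0r mulr_gt0.
  - by right; rewrite lz mulr0 addr0 mulr_gt0.
  - by right; rewrite addr_gt0 // mulr_gt0.
move=> a b t /lpos la /lpos lb /andP[t0 t1] zE.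
have t1' : 0 < 1 - t by rewrite subr_gt0.
have : l z = t * l a + (1 - t) * l b.
  by rewrite {1}zE /l !linB linD !linZ; ring.
have lz : l z = 0 by rewrite /l subrr /lin /= !mulr0 addr0.
rewrite lz => E.
have pos (x y : R) : 0 <= x -> 0 <= y -> 0 < x + y -> 0 <> t * x + (1 - t) * y.
  move=> x0 y0 xy0 {}E; have h1 := mulr_ge0 (ltW t0) x0; have h2 := mulr_ge0 (ltW t1') y0.
  have [xp|xn] := ltP 0 x; first by have := mulr_gt0 t0 xp; lra.
  by have yp : 0 < y; [lra|have := mulr_gt0 t1' yp; lra].
case: la lb E => [->|la] [->|lb] // E; exfalso; apply: (pos _ _ _ _ _ E);
  rewrite ?lz //; try exact: ltW.
- by rewrite add0r.
- by rewrite addr0.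
- exact: addr_gt0.
Qed.

End separation.

(** * Exposed families *)

Section exposed_family.
Context (R : realType) (p0 p2 : plane R) (n : nat).

(** The chain vertices are indexed by the sample together with two extra indices
for the end points; working with indices makes coincident points visible. *)
Definition vertex (t : n.-tuple (mplane R)) (x : 'I_n + bool) : plane R :=
  match x with inl i => tnth t i | inr b => if b then p2 else p0 end.

Definition chain_vertex (J : {set 'I_n}) (x : 'I_n + bool) : bool :=
  if x is inl i then i \in J else true.

Definition exposes (q : rat * rat) (t : n.-tuple (mplane R)) (x y : 'I_n + bool) :
    bool :=
  lin (ratr q.1) (ratr q.2) (vertex t x) < lin (ratr q.1) (ratr q.2) (vertex t y).

Definition exposed_family (t : n.-tuple (mplane R)) (J : {set 'I_n}) : Prop :=
  forall x, chain_vertex J x ->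
    exists q : rat * rat, forall y, chain_vertex J y -> y != x -> exposes q t x y.

(** Two distinct points always expose each other. *)
Lemma exposed_family0 t : p0 != p2 -> exposed_family t finset.set0.
Proof.
move=> p02.
pose s b : seq (plane R) := [:: if b then p0 - p2 else p2 - p0].
have sq b : exists q : rat * rat, forall v, v \in s b -> 0 < lin (ratr q.1) (ratr q.2) v.
  have [[a [c ac]]|h0] := gordan (s b); first exact: rational_lin ac.
  have : [set` s b] (0 : plane R).
    have : convex_hull [set` s b] `<=` [set` s b]; last exact.
    apply: convex_hull_min => [u v x _|//].
    rewrite /= !inE => /eqP -> /eqP ->.
    by rewrite -scalerDl addrCA subrr addr0 scale1r.
  rewrite /= inE; case: b {h0} => /eqP/esym/eqP; rewrite subr_eq0 => /eqP E;
    by rewrite E eqxx in p02.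
case=> [i|b] /=; first by rewrite inE.
have [q sqb] := sq b; exists q => -[i|b'] /=; first by rewrite inE.
move=> _ b'b; rewrite /exposes -subr_gt0 -linB.
apply: sqb; rewrite inE; apply/eqP.
by case: b b' b'b => -[].
Qed.

Lemma exposed_familyS t (J K : {set 'I_n}) : K \subset J ->
  exposed_family t J -> exposed_family t K.
Proof.
move=> /fintype.subsetP KJ eJ.
have sub x : chain_vertex K x -> chain_vertex J x by case: x => //= i /KJ.
move=> x /sub /eJ[q xq]; exists q => y /sub; exact: xq.
Qed.

Lemma exposed_family_local (t t' : n.-tuple (mplane R)) (J : {set 'I_n}) :
  (forall i, i \in J -> tnth t i = tnth t' i) ->
  exposed_family t J -> exposed_family t' J.
Proof.
move=> tt' eJ.
have vE x : chain_vertex J x -> vertex t x = vertex t' x.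
  by case: x => //= i /tt'.
move=> x xJ; have [q xq] := eJ x xJ; exists q => y yJ yx.
by have := xq y yJ yx; rewrite /exposes !vE.
Qed.

Lemma vertex_exposed_inj t (J : {set 'I_n}) : exposed_family t J ->
  {in chain_vertex J &, injective (vertex t)}.
Proof.
move=> eJ x y xJ yJ xy; apply/eqP; apply: contraT; rewrite eq_sym => yx.
by have [q /(_ y yJ yx)] := eJ x xJ; rewrite /exposes xy ltxx.
Qed.

Lemma measurable_exposes q x y : measurable [set t | exposes q t x y].
Proof.
have mlin z : measurable_fun setT (fun t => lin (ratr q.1) (ratr q.2) (vertex t z)).
  have mv : measurable_fun setT (fun t => (vertex t z : mplane R)).
    case: z => [i|b] /=; last exact: measurable_cst.
    exact: measurable_tnth.
  rewrite /lin; apply: measurable_funD; apply: measurable_funM;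
    try exact: measurable_cst.
    exact: (measurableT_comp measurable_fst mv).
  exact: (measurableT_comp measurable_snd mv).
have := measurable_fun_ltr (mlin x) (mlin y).
move=> /(_ measurableT [set true] I); rewrite setTI.
by congr measurable; apply/seteqP; split=> t.
Qed.

Lemma measurable_exposed_family (J : {set 'I_n}) :
  measurable [set t | exposed_family t J].
Proof.
rewrite (_ : [set t | _] = \bigcap_(x in [set x | chain_vertex J x])
   \bigcup_q \bigcap_(y in [set y | chain_vertex J y && (y != x)])
     [set t | exposes q t x y]); last first.
  apply/seteqP; split=> t /= eJ x xJ.
    have [q xq] := eJ x xJ; exists q => // y /= /andP[yJ yx]; exact: xq.
  have [q _ xq] := eJ x xJ; exists q => y yJ yx; apply: xq; exact/andP.
apply: fin_bigcap_measurable => [|x _]; first exact: finite_finset.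
apply: countable_bigcupT_measurable => [|q]; first exact: countableP.
by apply: fin_bigcap_measurable => [|y _]; [exact: finite_finset|exact: measurable_exposes].
Qed.

End exposed_family.

(** * Convex chains and exposed families *)

Section chain_config.
Context (R : realType) (p0 p2 : plane R) (n : nat).
Implicit Types (t : n.-tuple (mplane R)) (J : {set 'I_n}).

Definition chain_config t J : bool := `[< exposed_family p0 p2 t J >].

Definition family_points t J : {fset plane R} :=
  [fset (tnth t i : plane R) | i in J]%fset.

Let verts t J : seq (plane R) := [seq vertex p0 p2 t z | z <- enum (chain_vertex J)].

Let vertsP t J v : reflect (exists2 z, chain_vertex J z & v = vertex p0 p2 t z)
  (v \in verts t J).
Proof.
by apply: (iffP mapP) => -[z zJ ->]; exists z => //; move: zJ; rewrite mem_enum.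
Qed.

Let vertsE t J : [set` family_points t J] `|` [set p0; p2] = [set` verts t J].
Proof.
apply/seteqP; split=> v /=.
  case=> [/imfsetP[i /= iJ ->]|vp]; apply/vertsP; first by exists (inl i).
  by case: vp => ->; [exists (inr false)|exists (inr true)].
move=> /vertsP[[i|b] /= zJ ->]; first by left; apply/imfsetP; exists i.
by right; case: b {zJ}; [right|left].
Qed.

Lemma chain_of_exposed_family t J : exposed_family p0 p2 t J ->
  convex_chain p0 p2 (family_points t J) /\ #|` family_points t J| = #|J|.
Proof.
move=> eJ; have inj := vertex_exposed_inj eJ.
have neq x y : chain_vertex J x -> chain_vertex J y -> x != y ->
    vertex p0 p2 t x != vertex p0 p2 t y.
  by move=> xJ yJ; apply: contra => /eqP/(inj _ _ xJ yJ)/eqP.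
split; last first.
  rewrite card_in_imfset /=; first by rewrite -cardE.
  by move=> i j iJ jJ ij; apply: inl_inj; apply: inj.
apply/convex_chainP; split.
- exact: (neq (inr false) (inr true)).
- apply/imfsetP => -[i /= iJ /eqP]; apply/negP.
  exact: (neq (inr false) (inl i)).
- apply/imfsetP => -[i /= iJ /eqP]; apply/negP.
  exact: (neq (inr true) (inl i)).
rewrite vertsE => v vs; apply/extreme_exposed => //.
move/vertsP : vs => [z zJ ->]; have [q zq] := eJ z zJ; exists q => _ /vertsP[y yJ ->] yz.
rewrite linB subr_gt0; apply: zq => //.
by apply: contra_neq yz => ->.
Qed.

Lemma exposed_family_of_chain t J : {in J &, injective (tnth t)} ->
  convex_chain p0 p2 (family_points t J) -> exposed_family p0 p2 t J.
Proof.
move=> injJ /convex_chainP[p02 p0Y p2Y]; rewrite vertsE => ext z zJ.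
have zs : vertex p0 p2 t z \in verts t J by apply/vertsP; exists z.
have [q zq] := (extreme_exposed zs).1 (ext _ zs); exists q => y yJ yz.
rewrite /exposes -subr_gt0 -linB; apply: zq; first by apply/vertsP; exists y.
have inY i : i \in J -> (tnth t i : plane R) \in family_points t J.
  by move=> iJ; apply/imfsetP; exists i.
move: y z yJ zJ yz {zs} => [i|b] [j|c] /= iJ jJ ij.
- by apply: contra_neq ij => /(injJ _ _ iJ jJ) ->.
- apply: contraTneq (inY i iJ) => ->; by case: c {jJ ij}.
- rewrite eq_sym; apply: contraTneq (inY j jJ) => ->; by case: b {iJ ij}.
- by case: b c {iJ jJ} ij => [] [] //= _; rewrite eq_sym.
Qed.

(** A chain is a set of points, and a point may be sampled several times: each
point is represented by the least index at which it occurs. *)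
Lemma longest_convex_chainE (x : 'I_n -> plane R) :
  longest_convex_chain p0 p2 [fset x i | i : 'I_n]%fset =
  config_size chain_config [tuple (x i : mplane R) | i < n].
Proof.
set t := [tuple _ | i < n].
have tE i : tnth t i = x i by rewrite tnth_mktuple.
apply/eqP; rewrite eqn_leq; apply/andP; split.
  apply/bigmax_leqP_seq => Y; rewrite fpowersetE => /fsubsetP YS /asboolP cY.
  pose J := [set i : 'I_n | (x i \in Y) && [forall j : 'I_n, (x j == x i) ==> (i <= j)%N]]%SET.
  have injJ : {in J &, injective (tnth t)}.
    move=> i j; rewrite !inE !tE => /andP[_ /forallP iJ] /andP[_ /forallP jJ] xij.
    apply/val_inj/anti_leq; apply/andP; split.
      by have /implyP := iJ j; apply; rewrite xij.
    by have /implyP := jJ i; apply; rewrite xij.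
  have YE : Y = family_points t J.
    apply/fsetP => y; apply/idP/imfsetP => [yY|[i /= + ->]]; last first.
      by rewrite inE tE => /andP[].
    have /imfsetP[i0 /= _ y0] := YS y yY.
    have [i /eqP yi imin] := @arg_minnP _ i0 (fun i => y == x i) val (introT eqP y0).
    exists i; last by rewrite tE.
    rewrite inE -yi yY /=; apply/forallP => j; apply/implyP => /eqP xj.
    by apply: imin; rewrite xj.
  rewrite YE in cY *; have eJ := exposed_family_of_chain injJ cY.
  have [_ ->] := chain_of_exposed_family eJ.
  by apply: leq_bigmax_cond; apply/asboolP.
apply/bigmax_leqP => J /asboolP eJ.
have [cY <-] := chain_of_exposed_family eJ.
apply: (@leq_bigmax_seq _ _ (fun Y : {fset plane R} => `[< convex_chain p0 p2 Y >])
  (fun Y : {fset plane R} => #|` Y|)); last exact/asboolP.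
rewrite fpowersetE; apply/fsubsetP => y /imfsetP[i /= iJ ->]; apply/imfsetP.
by exists i => //; rewrite tE.
Qed.

End chain_config.

(** * Ordered chains in the standard triangle *)

Section ordered_chain.
Context (R : realType).

(** Here (a, b) is the last point of the chain so far and s the slope of its last
edge.  The next point must lie to the right of (a, b), on or above the line of
slope s through (a, b), and on or below the segment from (a, b) to (1, 1). *)
Definition chain_step (a b s : R) (v : R * R) : bool :=
  [&& a < v.1, v.1 <= 1, s * (v.1 - a) <= v.2 - b
    & (v.2 - b) * (1 - a) <= (1 - b) * (v.1 - a)].

Definition slope (a b : R) (v : R * R) : R := (v.2 - b) / (v.1 - a).

Fixpoint ordered_chain (a b s : R) (l : seq (R * R)) : bool :=
  if l is v :: l' then
    chain_step a b s v && ordered_chain v.1 v.2 (slope a b v) l'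
  else true.

(** The points u are those of a family in the triangle with vertices (0, 0),
(1, 0), (1, 1), the two extra indices giving the ends of the chain. *)
Context (I : finType) (J : {set I}) (u : I + bool -> R * R).

Let S (x : I + bool) : bool := if x is inl i then i \in J else true.

Hypotheses (u0 : u (inr false) = (0, 0)) (u1 : u (inr true) = (1, 1))
  (uJ : forall i, i \in J -> 0 <= (u (inl i)).2 <= (u (inl i)).1 /\ (u (inl i)).1 <= 1)
  (exposed : forall x, S x -> exists a b : R, forall y, S y -> y != x ->
     a * (u x).1 + b * (u x).2 < a * (u y).1 + b * (u y).2).

Let uS x : S x -> [/\ 0 <= (u x).2, (u x).2 <= (u x).1 & (u x).1 <= 1].
Proof.
case: x => [i /uJ[/andP[h1 h2] h3]|[] _]; first by split.
  by rewrite u1 /=; split; lra.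
by rewrite u0 /=; split; lra.
Qed.

(** The point of the side from (0, 0) to (1, 1) with the same abscissa is a
convex combination of the two end points, on which the exposing functional is
larger; so its vertical coefficient is positive. *)
Let exposed_above (i : I) : i \in J -> exists a b : R, b * ((u (inl i)).1 - (u (inl i)).2) > 0 /\
  forall y, S y -> y != inl i ->
     a * (u (inl i)).1 + b * (u (inl i)).2 < a * (u y).1 + b * (u y).2.
Proof.
move=> iJ; have [a [b ab]] := exposed (x := inl i) iJ.
exists a, b; split=> //.
have := ab (inr false) isT isT; have := ab (inr true) isT isT; rewrite u0 u1 /= => h1 h0.
have [h2 h3 h4] := uS (x := inl i) iJ.
move: (u (inl i)) h0 h1 h2 h3 h4 {ab} => [x y] /= h0 h1 h2 h3 h4.
have k0 : 0 < - (a * x + b * y) by lra.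
have k1 : 0 < a + b - (a * x + b * y) by lra.
have [x0|x0] := ltP 0 x; last first.
  have x_0 : x = 0 by lra.
  have y_0 : y = 0 by lra.
  by move: k0; rewrite x_0 y_0; lra.
have := mulr_gt0 x0 k1; have : 0 <= 1 - x by lra.
by move=> /mulr_ge0 /(_ (ltW k0)); lra.
Qed.

(** The upper one of two points on a vertical line lies between the lower one and
the side from (0, 0) to (1, 1). *)
Lemma exposed_abscissa_inj : {in J &, injective (fun i => (u (inl i)).1)}.
Proof.
suff main i j : i \in J -> j \in J -> i != j -> (u (inl i)).1 = (u (inl j)).1 ->
    (u (inl i)).2 <= (u (inl j)).2 -> False.
  move=> i j iJ jJ /= xij; apply/eqP; apply: contraT => nij; exfalso.
  have [h|/ltW h] := leP (u (inl i)).2 (u (inl j)).2; first exact: (main i j).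
  by apply: (main j i) => //; rewrite eq_sym.
move=> iJ jJ nij xij yij; have [a [b [b0 ab]]] := exposed_above jJ.
have := ab (inl i) iJ nij; rewrite xij ltrD2l => h.
have [_ h3 _] := uS (x := inl j) jJ.
have bn : b < 0.
  rewrite ltNge; apply/negP => b1; have := ler_wpM2l b1 yij; lra.
have : b * ((u (inl j)).1 - (u (inl j)).2) <= 0 by rewrite nmulr_rle0 // subr_ge0.
by rewrite leNgt b0.
Qed.

Lemma exposed_abscissa_gt0 i : i \in J -> 0 < (u (inl i)).1.
Proof.
move=> iJ; have [h2 h3 h4] := uS (x := inl i) iJ.
rewrite lt_def (le_trans h2 h3) andbT; apply/eqP => x0.
have y0 : (u (inl i)).2 = 0 by lra.
have [a [b [_ ab]]] := exposed_above iJ.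
by have := ab (inr false) isT isT; rewrite x0 y0 u0 ltxx.
Qed.

(** If the middle point were above the chord of the other two, the exposing
functional would have to decrease upwards, against [exposed_above]. *)
Lemma exposed_triple x (i : I) y : S x -> i \in J -> S y ->
  (u x).1 < (u (inl i)).1 -> (u (inl i)).1 < (u y).1 ->
  ((u (inl i)).2 - (u x).2) * ((u y).1 - (u (inl i)).1) <=
  ((u y).2 - (u (inl i)).2) * ((u (inl i)).1 - (u x).1).
Proof.
move=> xJ iJ yJ xi iy; have [a [b [b0 ab]]] := exposed_above iJ.
have hx := ab x xJ (_ : x != inl i); have hy := ab y yJ (_ : y != inl i).
have {}hx : a * (u (inl i)).1 + b * (u (inl i)).2 < a * (u x).1 + b * (u x).2.
  by apply: hx; apply: contraTneq xi => ->; rewrite ltxx.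
have {}hy : a * (u (inl i)).1 + b * (u (inl i)).2 < a * (u y).1 + b * (u y).2.
  by apply: hy; apply: contraTneq iy => ->; rewrite ltxx.
have [_ h3 _] := uS (x := inl i) iJ.
move: (u x) (u (inl i)) (u y) xi iy hx hy h3 b0 => [x1 x2] [i1 i2] [y1 y2] /=.
move=> xi iy hx hy h3 b0.
have bp : 0 < b.
  rewrite ltNge; apply/negP => bn; have := mulr_le0_ge0 bn (_ : 0 <= i1 - i2).
  by move=> /(_ ltac:(lra)); lra.
have p1 : 0 < y1 - i1 by lra.
have p2 : 0 < i1 - x1 by lra.
have := mulr_gt0 p1 (_ : 0 < a * x1 + b * x2 - (a * i1 + b * i2)).
have := mulr_gt0 p2 (_ : 0 < a * y1 + b * y2 - (a * i1 + b * i2)).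
move=> /(_ ltac:(lra)) q2 /(_ ltac:(lra)) q1.
have : 0 < b * ((y2 - i2) * (i1 - x1) - (i2 - x2) * (y1 - i1)) by lra.
by rewrite pmulr_rgt0 // => h; lra.
Qed.

(** Listing the points by increasing abscissa works: slopes increase along the
list by [exposed_triple], also when its last point is (1, 1). *)
Lemma ordered_chain_of_exposed : exists L : seq I,
  [/\ uniq L, {subset L <= J}, size L = #|J| &
      ordered_chain 0 0 0 [seq u (inl i) | i <- L]].
Proof.
pose r i j := (u (inl i)).1 <= (u (inl j)).1.
have rtr : transitive r by move=> j i k; exact: le_trans.
have rtot : total r by move=> i j; exact: le_total.
pose L := sort r (enum J).
have LJ : {subset L <= J} by move=> i; rewrite mem_sort mem_enum.
exists L; split => //; first by rewrite sort_uniq enum_uniq.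
  by rewrite size_sort -cardE.
have : pairwise r L by rewrite -sorted_pairwise // sort_sorted.
have : uniq L by rewrite sort_uniq enum_uniq.
have main (L' : seq I) z (s : R) : S z -> {subset L' <= J} -> uniq L' -> pairwise r L' ->
    (forall i, i \in L' -> (u z).1 < (u (inl i)).1) ->
    (forall i, i \in L' -> s * ((u (inl i)).1 - (u z).1) <= (u (inl i)).2 - (u z).2) ->
    ordered_chain (u z).1 (u z).2 s [seq u (inl i) | i <- L'].
  elim: L' z s => //= i L' IH z s zS L'J /andP[iL' uL'] /andP[/allP ri pL'] zL sL.
  have iJ : i \in J by apply: L'J; rewrite mem_head.
  have zi := zL i (mem_head _ _).
  have [h2 h3 h4] := uS (x := inl i) iJ.
  have iL j : j \in L' -> (u (inl i)).1 < (u (inl j)).1.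
    move=> jL; have rij : (u (inl i)).1 <= (u (inl j)).1 := ri j jL.
    rewrite lt_def rij andbT; apply: contraNneq iL' => xji.
    rewrite -(exposed_abscissa_inj _ _ xji) //.
    by apply: L'J; rewrite in_cons jL orbT.
  have sub' : {subset L' <= J} by move=> j jL; apply: L'J; rewrite in_cons jL orbT.
  rewrite /chain_step zi h4 (sL i (mem_head _ _)) /=; apply/andP; split.
    have [x1|x1] := eqVneq (u (inl i)).1 1.
      by rewrite x1 in zi h3 *; rewrite ler_wpM2r //; lra.
    have := exposed_triple (y := inr true) zS iJ isT zi; rewrite u1 /= => /(_ _).
    by rewrite lt_def eq_sym x1 h4 => /(_ isT) h; lra.
  apply: (IH (inl i)) => // j jL.
  rewrite /slope mulrAC ler_pdivrMr; last by rewrite subr_gt0.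
  by apply: exposed_triple => //; [exact: sub'|exact: iL].
move=> uL pL; have := main L (inr false) 0; rewrite u0 /=; apply=> //.
  by move=> i /LJ; exact: exposed_abscissa_gt0.
by move=> i /LJ iJ; rewrite mul0r subr0; have [] := uS (x := inl i) iJ.
Qed.

End ordered_chain.

(** * The beta integral of the remaining area *)

Section chain_integral.
Context (R : realType).
Local Notation leb := (@lebesgue_measure R).

Lemma integral_deriv_poly (p : {poly R}) (a b : R) : a <= b ->
  (\int[leb]_(x in `[a, b]) ((deriv p).[x])%:E = (p.[b] - p.[a])%:E)%E.
Proof.
rewrite le_eqVlt => /predU1P[->|ab].
  by rewrite subrr set_itv1 integral_set1.
rewrite (@continuous_FTC2 _ (horner (deriv p)) (horner p)) ?EFinB //.
- by apply: continuous_subspaceT => x; exact: continuous_horner.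
- split=> [x _||].
  + exact: derivable_horner.
  + by apply: cvg_at_right_filter; exact: continuous_horner.
  + by apply: cvg_at_left_filter; exact: continuous_horner.
- by move=> x _; rewrite -derivE.
Qed.

Lemma integral_affine_pow (A B y0 y1 : R) (k : nat) : y0 <= y1 -> B != 0 ->
  (\int[leb]_(y in `[y0, y1]) ((A - B * y) ^+ k)%:E =
   (((A - B * y0) ^+ k.+1 - (A - B * y1) ^+ k.+1) / (B * k.+1%:R))%:E)%E.
Proof.
move=> y01 B0.
pose p : {poly R} := (- (B * k.+1%:R)^-1) *: (A%:P - B *: 'X) ^+ k.+1.
have k0 : k.+1%:R != 0 :> R by rewrite pnatr_eq0.
have E y : (deriv p).[y] = (A - B * y) ^+ k.
  rewrite /p derivZ deriv_exp !poly.derivE hornerZ hornerMn hornerM horner_exp !hornerE /= -[X in _ * X]mulr_natr.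
  by move: k0; move: (k.+1%:R : R) => K K0; field; rewrite K0.
under eq_integral => y _ do rewrite -E.
rewrite integral_deriv_poly //; congr EFin.
rewrite /p !hornerZ !horner_exp !hornerE /=.
by move: k0; move: (k.+1%:R : R) => K K0; field; rewrite K0.
Qed.

(** Twice the area of the triangle with vertices (a, b), (1, 1) and
(1, b + s (1 - a)), in which the rest of the chain must lie. *)
Definition narea (a b s : R) : R := (1 - a) * (1 - b - s * (1 - a)).

(** The k-th power of the area left for the rest of the chain after the step
to v. *)
Definition step_weight (k : nat) (a b s : R) (v : measurableTypeR R * measurableTypeR R) : R :=
  if chain_step a b s v then narea v.1 v.2 (slope a b v) ^+ k else 0.

Lemma step_weight_ge0 k a b s v : 0 <= step_weight k a b s v.
Proof.
rewrite /step_weight /chain_step; case: ifP => // /and4P[h1 h2 h3 h4].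
apply: exprn_ge0; rewrite /narea mulr_ge0 ?subr_ge0 //.
rewrite /slope mulrAC ler_pdivrMr ?subr_gt0 //; lra.
Qed.

Lemma measurable_invr : measurable_fun setT (GRing.inv : R -> R).
Proof.
rewrite (_ : GRing.inv = (fun x : R => if 0 < x then expR (- ln x) else
    if x < 0 then - expR (- ln (- x)) else 0)).
  apply: measurable_fun_ifT.
  - by apply: measurable_fun_ltr => //; exact: measurable_cst.
  - apply: (measurableT_comp (@measurable_expR R)).
    exact: (measurableT_comp (@oppr_measurable R setT) (@measurable_ln R)).
  apply: measurable_fun_ifT => //.
  - by apply: measurable_fun_ltr => //; exact: measurable_cst.
  - apply: measurableT_comp => //; apply: (measurableT_comp (@measurable_expR R)).
    apply: measurableT_comp => //; apply: (measurableT_comp (@measurable_ln R)).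
    exact: (@oppr_measurable R setT).
apply/funext => x; case: ltgtP => x0.
- by rewrite expRN lnK ?posrE.
- by rewrite expRN lnK ?posrE ?oppr_gt0 // invrN opprK.
- by rewrite -x0 invr0.
Qed.

Lemma measurable_chain_step d (T : measurableType d) (a b s : T -> R)
    (v : T -> measurableTypeR R * measurableTypeR R) :
  measurable_fun setT a -> measurable_fun setT b -> measurable_fun setT s ->
  measurable_fun setT v ->
  measurable_fun setT (fun w => chain_step (a w) (b w) (s w) (v w)).
Proof.
move=> ma mb ms mv.
have mv1 : measurable_fun setT (fun w => (v w).1 : R).
  exact: (measurableT_comp measurable_fst mv).
have mv2 : measurable_fun setT (fun w => (v w).2 : R).
  exact: (measurableT_comp measurable_snd mv).
have m1 : measurable_fun setT (cst 1 : T -> R) by exact: measurable_cst.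
apply: measurable_and; first exact: measurable_fun_ltr.
apply: measurable_and; first exact: measurable_fun_ler.
apply: measurable_and.
  apply: measurable_fun_ler; last exact: measurable_funB.
  by apply: measurable_funM => //; exact: measurable_funB.
by apply: measurable_fun_ler; apply: measurable_funM; apply: measurable_funB.
Qed.

Lemma measurable_slope d (T : measurableType d) (a b : T -> R)
    (v : T -> measurableTypeR R * measurableTypeR R) :
  measurable_fun setT a -> measurable_fun setT b -> measurable_fun setT v ->
  measurable_fun setT (fun w => slope (a w) (b w) (v w)).
Proof.
move=> ma mb mv.
have mv1 : measurable_fun setT (fun w => (v w).1 : R).
  exact: (measurableT_comp measurable_fst mv).
have mv2 : measurable_fun setT (fun w => (v w).2 : R).
  exact: (measurableT_comp measurable_snd mv).
apply: measurable_funM; first exact: measurable_funB.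
by apply: (measurableT_comp measurable_invr); exact: measurable_funB.
Qed.

Lemma measurable_step_weight k a b s : measurable_fun setT (step_weight k a b s).
Proof.
have mi := @measurable_id _ (measurableTypeR R * measurableTypeR R)%type setT.
have mv1 : measurable_fun setT (fun w : measurableTypeR R * measurableTypeR R => w.1 : R).
  exact: measurable_fst.
have mv2 : measurable_fun setT (fun w : measurableTypeR R * measurableTypeR R => w.2 : R).
  exact: measurable_snd.
apply: measurable_fun_ifT => //.
  by apply: (@measurable_chain_step _ _ (cst a) (cst b) (cst s) id) => //; exact: measurable_cst.
apply: measurable_funX; rewrite /narea.
have ms : measurable_fun setT (fun w : measurableTypeR R * measurableTypeR R => slope a b w).
  by apply: (@measurable_slope _ _ (cst a) (cst b) id) => //; exact: measurable_cst.
have m1 : measurable_fun setT (cst 1 : measurableTypeR R * measurableTypeR R -> R).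
  exact: measurable_cst.
apply: measurable_funM; first exact: measurable_funB.
apply: measurable_funB; first exact: measurable_funB.
by apply: measurable_funM => //; exact: measurable_funB.
Qed.

(** On a vertical line the remaining area is an affine function of the ordinate;
it vanishes at the upper end y1 of the section. *)
Lemma integral_step_weight_section k (a b s x : R) : a < x <= 1 ->
  0 <= 1 - b - s * (1 - a) ->
  (\int[leb]_y (step_weight k a b s (x, y))%:E <=
   ((1 - x) ^+ k * (x - a) *
    ((1 - b - s * (1 - a)) ^+ k.+1 / (k.+1%:R * (1 - a))))%:E)%E.
Proof.
move=> /andP[ax x1] h0.
pose w := x - a; pose r := 1 - a; pose h := 1 - b - s * r.
have w0 : 0 < w by rewrite subr_gt0.
have r0 : 0 < r by rewrite /r; lra.
have w_neq0 : w != 0 by rewrite gt_eqF.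
have r_neq0 : r != 0 by rewrite gt_eqF.
have k0 : k.+1%:R != 0 :> R by rewrite pnatr_eq0.
pose y0 := b + s * w; pose y1 := b + (1 - b) * w / r.
pose B := (1 - x) * r / w; pose A := (1 - x) * (1 - b) + B * b.
have y01 : y0 <= y1.
  rewrite lerD2l ler_pdivlMr //; have : 0 <= w * h by rewrite mulr_ge0 // ltW.
  by rewrite /h; lra.
pose f (y : R) := (1 - x) ^+ k * ((1 - b + r / w * b) - r / w * y) ^+ k.
have -> : (\int[leb]_y (step_weight k a b s (x, y))%:E =
    \int[leb]_(y in `[y0, y1]) (f y)%:E)%E.
  rewrite [RHS]integral_mkcond; apply: eq_integral => y _.
  rewrite patchE mem_setE in_itv /= /step_weight /chain_step /= ax x1 /=.
  rewrite -/w -/r {1}/y0 -lerBrDl.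
  have -> : (y <= y1) = ((y - b) * r <= (1 - b) * w).
    by rewrite /y1 -lerBlDl ler_pdivlMr.
  case: ifP => // _; congr EFin; rewrite /f -exprMn; congr (_ ^+ k).
  rewrite /narea /slope /= -/w; rewrite /r /w in w_neq0 *.
  by field.
have rw0 : r / w != 0 by rewrite mulf_neq0 ?invr_eq0.
have -> : (\int[leb]_(y in `[y0, y1]) (f y)%:E = ((1 - x) ^+ k)%:E *
   \int[leb]_(y in `[y0, y1]) (((1 - b + r / w * b) - r / w * y) ^+ k)%:E)%E.
  rewrite -ge0_integralZl //=.
  - apply/measurable_EFinP; apply: measurable_funX.
    apply: measurable_funB; first exact: measurable_cst.
    by apply: measurable_funM; [exact: measurable_cst|exact: measurable_id].
  - move=> y; rewrite in_itv /= => /andP[_ yy1]; rewrite lee_fin exprn_ge0 //.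
    have : r / w * y <= r / w * y1 by rewrite ler_wpM2l // divr_ge0 // ltW.
    have : r / w * y1 = 1 - b + r / w * b by rewrite /y1; field; rewrite w_neq0.
    lra.
  - by rewrite lee_fin exprn_ge0 // subr_ge0.
rewrite integral_affine_pow // -EFinM lee_fin.
rewrite le_eqVlt; apply/orP; left; apply/eqP.
have -> : 1 - b + r / w * b - r / w * y0 = h by rewrite /y0 /h; field.
have -> : 1 - b + r / w * b - r / w * y1 = 0 by rewrite /y1; field; rewrite ?w_neq0 ?r_neq0.
rewrite expr0n /= subr0 -/r -/h -/w; field.
by rewrite w_neq0 r_neq0 nat1r k0.
Qed.

(** The sections integrate to the beta integral of (1 - x)^k (x - a) over
[a, 1].  Only the power of the initial area depends on a, b and s, so that the
bound reproduces itself when it is iterated. *)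
Lemma integral_step_weight k (a b s : R) : a < 1 -> 0 <= 1 - b - s * (1 - a) ->
  (\int[leb]_x \int[leb]_y (step_weight k a b s (x, y))%:E <=
   (narea a b s ^+ k.+1 / (k.+1%:R ^+ 2 * k.+2%:R))%:E)%E.
Proof.
move=> a1 h0; pose r := 1 - a; pose h := 1 - b - s * r.
have r0 : 0 < r by rewrite subr_gt0.
have k10 : k.+1%:R != 0 :> R by rewrite pnatr_eq0.
have k20 : k.+2%:R != 0 :> R by rewrite pnatr_eq0.
pose c := h ^+ k.+1 / (k.+1%:R * r).
have c0 : 0 <= c by rewrite divr_ge0 ?exprn_ge0 // mulr_ge0 // ltW.
pose p : {poly R} := (- (c * r / k.+1%:R)) *: (1%:P - 'X) ^+ k.+1 +
  (c / k.+2%:R) *: (1%:P - 'X) ^+ k.+2.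
have pE x : (deriv p).[x] = (1 - x) ^+ k * (x - a) * c.
  rewrite /p; move: (c) => e; rewrite derivD !derivZ !deriv_exp !poly.derivE hornerD !hornerZ !hornerMn.
  rewrite !hornerM !horner_exp !hornerE /= -![X in _ * X + _]mulr_natr -![X in _ + _ * X]mulr_natr.
  rewrite /r !exprS; move: k10 k20; rewrite -![_.+1%:R]nat1r; move: (1 + k%:R) => K K0 K10.
  by field; rewrite K0 K10.
have : (\int[leb]_x \int[leb]_y (step_weight k a b s (x, y))%:E <=
    \int[leb]_(x in `[a, 1%R]) ((deriv p).[x])%:E)%E.
  rewrite [leRHS]integral_mkcond; apply: ge0_le_integral => //.
  - by move=> x _; apply: integral_ge0 => y _; rewrite lee_fin step_weight_ge0.
  - apply: (@measurable_fun_fubini_tonelli_F _ _ _ _ _ leb (fun v => (step_weight k a b s v)%:E)).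
      by apply/measurable_EFinP; exact: measurable_step_weight.
    by move=> v; rewrite lee_fin step_weight_ge0.
  - apply: (proj1 (measurable_restrictT _ _)) => //; apply/measurable_EFinP.
    apply: measurable_funTS; apply: continuous_measurable_fun; exact: continuous_horner.
  move=> x _; rewrite patchE mem_setE in_itv /=; case: ifP => [/andP[ax x1]|axn].
    rewrite pE; move: ax; rewrite le_eqVlt => /predU1P[<-|ax].
      rewrite subrr mulr0 mul0r integral0_eq // => y _.
      by rewrite /step_weight /chain_step /= ltxx.
    by apply: integral_step_weight_section => //; rewrite ax.
  rewrite integral0_eq // => y _; rewrite /step_weight /chain_step /=.
  case: ifP => // /andP[ax /andP[x1 _]].
  by rewrite x1 (ltW ax) in axn.
move=> /le_trans; apply; rewrite (integral_deriv_poly _ (ltW a1)) lee_fin.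
rewrite /p !(hornerD, hornerZ, horner_exp, hornerN, hornerC, hornerX) subrr !expr0n /= !mulr0 addr0 sub0r.
rewrite le_eqVlt; apply/orP; left; apply/eqP.
rewrite /narea -/r -/h /c exprMn !exprS.
have rn : r != 0 by rewrite gt_eqF.
move: k10 k20; rewrite -![_.+1%:R]nat1r; move: (1 + k%:R) => K K0 K10.
by field; rewrite K0 K10 rn.
Qed.

End chain_integral.

(** * Probability of an ordered chain *)

Section chain_probability.
Context (R : realType) (d : measure_display) (V : measurableType d) (n : nat).
Context (mu : probability V R).
Context (rho : probability (n.-tuple V) R) (rhoP : iid_law mu rho).
Context (phi : V -> mplane R).
Hypotheses (mphi : measurable_fun setT phi)
  (phi_law : forall A, measurable A -> (mu (phi @^-1` A) <= 2%:E * area A)%E).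

Lemma integral_phi_le (g : mplane R -> R) : measurable_fun setT g ->
  (forall x, 0 <= g x) ->
  (\int[mu]_v (g (phi v))%:E <= 2%:E *
   \int[@lebesgue_measure R]_x \int[@lebesgue_measure R]_y (g (x, y))%:E)%E.
Proof.
move=> mg g0.
have mg' : measurable_fun setT (EFin \o g) by exact/measurable_EFinP.
have g0' x : (0 <= (EFin \o g) x)%E by rewrite lee_fin.
pose f : {RV mu >-> mplane R} := mfun_Sub (mem_set mphi).
pose leb2 := (@lebesgue_measure R \x @lebesgue_measure R)%E.
have -> : (\int[mu]_v (g (phi v))%:E = \int[distribution mu f]_x (g x)%:E)%E.
  by rewrite (ge0_integral_distribution f mg' g0').
rewrite -(@fubini_tonelli1 _ _ _ _ _ (@lebesgue_measure R) (@lebesgue_measure R) (EFin \o g)) //.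
rewrite -/leb2.
have <- := @ge0_integral_mscale _ _ R leb2 setT measurableT (2%:nng) (EFin \o g) mg' (fun x _ => g0' x).
exact: ge0_le_measure_integral.
Qed.

(** The product of the constants of [integral_step_weight], each doubled because
the density is at most 2; in closed form 2^k / (k!^2 (k+1)!). *)
Fixpoint chain_coef (k : nat) : R :=
  if k is k'.+1 then chain_coef k' * (2 / (k%:R ^+ 2 * k.+1%:R)) else 1.

Lemma chain_coef_ge0 k : 0 <= chain_coef k.
Proof.
by elim: k => //= k IH; apply: mulr_ge0 => //; apply: divr_ge0.
Qed.

Lemma measurable_ordered_chain d' (T : measurableType d') (a b s : T -> R)
    (l : seq (T -> mplane R)) :
  measurable_fun setT a -> measurable_fun setT b -> measurable_fun setT s ->
  (forall f, List.In f l -> measurable_fun setT f) ->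
  measurable_fun setT (fun w => ordered_chain (a w) (b w) (s w) [seq f w | f <- l]).
Proof.
elim: l a b s => [|f l IH] a b s ma mb ms ml /=; first exact: measurable_cst.
have mf : measurable_fun setT f by apply: ml; left.
apply: measurable_and; first exact: measurable_chain_step.
apply: IH.
- exact: (measurableT_comp measurable_fst mf).
- exact: (measurableT_comp measurable_snd mf).
- exact: measurable_slope.
- by move=> g gl; apply: ml; right.
Qed.

Lemma measurable_ordered_chain_tuple (L : seq 'I_n) (a b s : R) : measurable
  [set t | ordered_chain a b s [seq (phi (tnth t i) : R * R) | i <- L]].
Proof.
have mtn i : measurable_fun setT (fun t : n.-tuple V => phi (tnth t i)).
exact: (measurableT_comp mphi (measurable_tnth i)).
have := @measurable_ordered_chain _ _ (cst a) (cst b) (cst s)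
[seq (fun t : n.-tuple V => phi (tnth t i)) | i <- L].
move=> /(_ (measurable_cst _) (measurable_cst _) (measurable_cst _)) h.
have /h {}h : forall f, List.In f [seq (fun t : n.-tuple V => phi (tnth t i)) | i <- L] ->
  measurable_fun setT f.
  by move=> f; elim: L {h} => //= i L IH [<-|//]; exact: mtn.
have := h measurableT [set true] I; rewrite setTI; congr measurable.
apply/seteqP; split=> t /=; rewrite -map_comp //.
Qed.

(** By induction on the number of points: the first point is integrated out
last, and for each of its positions the induction hypothesis bounds the
probability of the rest by a power of the remaining area. *)
Lemma ordered_chain_prob (L : seq 'I_n) (a b s : R) : uniq L -> a <= 1 ->
  0 <= 1 - b - s * (1 - a) ->
  (rho [set t | ordered_chain a b s [seq (phi (tnth t i) : R * R) | i <- L]] <=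
   (chain_coef (size L) * narea a b s ^+ size L)%:E)%E.
Proof.
elim: L a b s => [|i L IH] a b s /=.
  move=> _ _ _; rewrite mul1r expr0; apply: probability_le1.
  exact: (measurable_ordered_chain_tuple [::] a b s).
move=> /andP[iL uL] a1 h0.
move: (a1); rewrite le_eqVlt => /predU1P[a_1|lt_a1].
  rewrite (_ : [set t | _] = set0) ?measure0.
    by rewrite lee_fin /narea a_1 subrr mul0r expr0n mulr0.
  apply/seteqP; split=> t //=; rewrite /chain_step a_1.
  by move=> /andP[/and4P[h1 h2 _ _] _]; move: (lt_le_trans h1 h2); rewrite ltxx.
pose E := [set t : n.-tuple V | ordered_chain a b s [seq (phi (tnth t j) : R * R) | j <- i :: L]].
pose G (v : V) := [set t : n.-tuple V | ordered_chain (phi v).1 (phi v).2 (slope a b (phi v))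
   [seq (phi (tnth t j) : R * R) | j <- L]].
pose F (tv : n.-tuple V * V) : R :=
  (chain_step a b s (phi tv.2) && (ordered_chain (phi tv.2).1 (phi tv.2).2
     (slope a b (phi tv.2)) [seq (phi (tnth tv.1 j) : R * R) | j <- L]))%:R.
have mE : measurable E by exact: (measurable_ordered_chain_tuple (i :: L) a b s).
have FE t v : F (t, v) = \1_E (resample i t v).
  rewrite /F indicE; congr (nat_of_bool _)%:R.
  have -> : (resample i t v \in E) =
      ordered_chain a b s [seq (phi (tnth (resample i t v) j) : R * R) | j <- i :: L].
    by apply/idP/idP; rewrite inE.
  rewrite /= tnth_resample eqxx; congr (_ && ordered_chain _ _ _ _).
  apply/eq_in_map => j jL; rewrite tnth_resample; case: eqP => // /val_inj ji.
  by rewrite -ji jL in iL.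
have mF : measurable_fun setT F.
  have -> : F = \1_E \o (fun tv : n.-tuple V * V => resample i tv.1 tv.2).
    by apply/funext => -[t v]; rewrite /= -FE.
  apply: measurableT_comp; first exact: measurable_indic.
  exact: measurable_resample.
have F0 x : 0 <= F x by rewrite /F ler0n.
have -> : (rho E = \int[rho]_t (\1_E t)%:E)%E by rewrite integral_indic // setIT.
have mIE : measurable_fun setT (EFin \o \1_E : n.-tuple V -> \bar R).
  by apply/measurable_EFinP; exact: measurable_indic.
rewrite (@ge0_integral_resample _ _ _ _ _ _ rhoP i (EFin \o \1_E)) //; last first.
  by move=> t; rewrite lee_fin indicE ler0n.
have -> : (\int[rho]_t \int[mu]_v ((EFin \o \1_E) (resample i t v)) =
   \int[mu]_v \int[rho]_t (F (t, v))%:E)%E.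
  rewrite -(@fubini_tonelli _ _ _ _ _ rho mu (EFin \o F)) //; last first.
    exact/measurable_EFinP.
  by apply: eq_integral => t _; apply: eq_integral => v _; rewrite /= FE.
set c := chain_coef (size L).
have c0 : 0 <= c := chain_coef_ge0 _.
have mW := @measurable_step_weight R (size L) a b s.
have W0 := @step_weight_ge0 R (size L) a b s.
apply: (@le_trans _ _ (\int[mu]_v (c * step_weight (size L) a b s (phi v))%:E)%E).
  apply: ge0_le_integral => //.
  - by move=> v _; apply: integral_ge0 => t _; rewrite lee_fin.
  - apply: (@measurable_fun_fubini_tonelli_G _ _ _ _ _ rho (EFin \o F)) => //.
    exact/measurable_EFinP.
  - apply/measurable_EFinP; apply: measurable_funM; first exact: measurable_cst.
    exact: (measurableT_comp mW mphi).
  move=> v _; rewrite /F /step_weight /=; case: ifP => st; last first.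
    by rewrite mulr0 integral0_eq.
  have -> : (\int[rho]_t (true && ordered_chain (phi v).1 (phi v).2 (slope a b (phi v))
     [seq (phi (tnth t j) : R * R) | j <- L])%:R%:E)%E = rho (G v).
    have mG : measurable (G v) by exact: measurable_ordered_chain_tuple.
    transitivity (\int[rho]_t (\1_(G v) t)%:E)%E; last by rewrite integral_indic // setIT.
    apply: eq_integral => t _; rewrite indicE; congr (nat_of_bool _)%:R%:E.
    by apply/idP/idP; rewrite inE.
  move: st => /and4P[h1 h2 h3 h4]; apply: IH => //.
  rewrite /slope mulrAC subr_ge0 ler_pdivrMr ?subr_gt0 //; lra.
have mcW : measurable_fun setT (fun v => c * step_weight (size L) a b s v).
  by apply: measurable_funM => //; exact: measurable_cst.
apply: (le_trans (integral_phi_le mcW (fun v => mulr_ge0 c0 (W0 v)))).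
have -> : (\int[@lebesgue_measure R]_x \int[@lebesgue_measure R]_y
    (c * step_weight (size L) a b s (x, y))%:E = c%:E *
   \int[@lebesgue_measure R]_x \int[@lebesgue_measure R]_y
    (step_weight (size L) a b s (x, y))%:E)%E.
  rewrite -ge0_integralZl //; last 2 first.
  - apply: (@measurable_fun_fubini_tonelli_F _ _ _ _ _ (@lebesgue_measure R)
      (fun v => (step_weight (size L) a b s v)%:E)) => //.
    exact/measurable_EFinP.
  - by move=> x _; apply: integral_ge0 => y _; rewrite lee_fin.
  apply: eq_integral => x _; rewrite -ge0_integralZl //.
  - apply/measurable_EFinP; exact: (measurableT_comp mW (pair1_measurable x)).
  - by move=> y _; rewrite lee_fin.
apply: (@le_trans _ _ (2%:E * (c%:E * (narea a b s ^+ (size L).+1 /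
    ((size L).+1%:R ^+ 2 * (size L).+2%:R))%:E))%E).
  do 2 (apply: lee_wpmul2l; first by rewrite lee_fin).
  exact: integral_step_weight.
rewrite -!EFinM lee_fin /= le_eqVlt; apply/orP; left; apply/eqP.
rewrite -/c; move: (_ ^+ _.+1) ((size L).+1%:R) ((size L).+2%:R) => x y z; ring.
Qed.

End chain_probability.

(** * Area under affine maps *)

Section affine_area.
Context (R : realType).
Local Notation leb := (@lebesgue_measure R).
Local Notation line := (measurableTypeR R).

Let affine (q c : R) (y : line) : line := q * y + c.

Let measurable_affine q c : measurable_fun setT (affine q c).
Proof.
apply: measurable_funD; last exact: measurable_cst.
by apply: measurable_funM; [exact: measurable_cst|exact: measurable_id].
Qed.

Lemma lebesgue_measure_affine (q c : R) (A : set line) : q != 0 -> measurable A ->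
  (leb (affine q c @^-1` A) = `|q|^-1%:E * leb A)%E.
Proof.
move=> q0 mA; have maff := measurable_affine q c.
have nq0 : 0 < `|q| by rewrite normr_gt0.
pose k : {nonneg R} := NngNum (ltW nq0).
suff : (mscale k (pushforward leb (affine q c)) A = leb A)%E.
  rewrite /mscale /= => <-.
  by rewrite muleA -EFinM mulVf ?gt_eqF // mul1e.
- exact: maff.
move=> m.
apply/esym/lebesgue_measure_unique => //= _ [[a b] /= _ <-].
change (leb `]a, b]%classic = (`|q|%:E * leb (affine q c @^-1` `]a, b]%classic))%E).
have [q1|q1] : 0 < q \/ q < 0 by move: q0; rewrite neq_lt => /orP[|]; [right|left].
  rewrite (_ : affine q c @^-1` _ = [set` `](a - c) / q, (b - c) / q]]).
    rewrite !lebesgue_measure_itv /= !lte_fin ltr_pM2r ?invr_gt0 // ltrD2r.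
    case: ifP => _; last by rewrite mule0.
    by rewrite -!EFinB -EFinM gtr0_norm //; congr EFin; field; rewrite gt_eqF.
  apply/seteqP; split=> y /=; rewrite !in_itv /= /affine.
    by rewrite ltr_pdivrMr // ler_pdivlMr // ![y * q]mulrC ltrBlDr lerBrDr.
  by rewrite ltr_pdivrMr // ler_pdivlMr // ![y * q]mulrC ltrBlDr lerBrDr.
rewrite (_ : affine q c @^-1` _ = [set` `[(b - c) / q, (a - c) / q[]).
  rewrite !lebesgue_measure_itv /= !lte_fin ltr_nM2r ?invr_lt0 // ltrD2r.
  case: ifP => _; last by rewrite mule0.
  rewrite -!EFinB -EFinM ltr0_norm //; congr EFin; field; rewrite lt_eqF //.
apply/seteqP; split=> y /=; rewrite !in_itv /= /affine.
  by rewrite ltr_ndivlMr // ler_ndivrMr // ![y * q]mulrC ltrBlDr lerBrDr andbC.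
by rewrite ltr_ndivlMr // ler_ndivrMr // ![y * q]mulrC ltrBlDr lerBrDr andbC.
Qed.

Implicit Type B : set (mplane R).

Lemma area_preimage_shear (q : R) (g : line -> line) B : q != 0 ->
  measurable_fun setT g -> measurable B ->
  area [set v | B (v.1, q * v.2 + g v.1)] = (`|q|^-1%:E * area B)%E.
Proof.
move=> q0 mg mB; rewrite /area /product_measure1.
have mx := @measurable_fun_xsection _ _ line line R leb B mB.
rewrite -(@ge0_integralZl _ _ _ leb setT measurableT (leb \o xsection B) mx `|q|^-1%:E) //.
apply: eq_integral => x _ /=.
rewrite -(lebesgue_measure_affine (g x)) //; last exact: measurable_xsection.
Qed.

Lemma measurable_shear (q : R) (g : line -> line) : measurable_fun setT g ->
  measurable_fun setT (fun v : mplane R => (v.1, q * v.2 + g v.1) : mplane R).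
Proof.
move=> mg; apply: measurable_fun_pair; first exact: measurable_fst.
apply: measurable_funD; last exact: (measurableT_comp mg measurable_fst).
by apply: measurable_funM; [exact: measurable_cst|exact: measurable_snd].
Qed.

Lemma area_preimage_swap B : measurable B -> area [set v | B (v.2, v.1)] = area B.
Proof.
move=> mB; have := @indic_fubini_tonelli _ _ _ _ _ leb leb B mB.
rewrite indic_fubini_tonelli_FE // indic_fubini_tonelli_GE // /area /product_measure1 => ->.
Qed.

(** When a is not 0, the map is a composition of two maps each of which is affine
in one coordinate with the other coordinate as a parameter; swapping the
coordinates before and after turns the first of them into a shear of the same
form as the second. *)
Lemma area_preimage_affine0 (a b c a' b' c' : R) B : a != 0 ->
  a * b' - b * a' != 0 -> measurable B ->
  area [set v | B (a * v.1 + b * v.2 + c, a' * v.1 + b' * v.2 + c')] =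
  (`|a * b' - b * a'|^-1%:E * area B)%E.
Proof.
move=> a0 D0 mB; pose D := a * b' - b * a'.
pose B' : set (mplane R) := [set v | B (v.1, D / a * v.2 + (a' / a * v.1 + (c' - a' / a * c)))].
have mg : measurable_fun setT (fun x : line => a' / a * x + (c' - a' / a * c) : line).
  exact: measurable_affine.
have mB' : measurable B'.
  by have := measurable_shear (D / a) mg measurableT mB; rewrite setTI.
pose B1 : set (mplane R) := [set w | B' (w.2, w.1)].
have mB1 : measurable B1.
  by have := @measurable_swap _ _ line line measurableT _ mB'; rewrite setTI.
have D1 : D / a != 0 by rewrite mulf_neq0 // invr_eq0.
have mh : measurable_fun setT (fun y : line => b * y + c : line) by exact: measurable_affine.
pose B2 : set (mplane R) := [set w | B1 (w.1, a * w.2 + (b * w.1 + c))].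
have mB2 : measurable B2.
  by have := measurable_shear a mh measurableT mB1; rewrite setTI.
have -> : [set v : mplane R | B (a * v.1 + b * v.2 + c, a' * v.1 + b' * v.2 + c')] =
   [set v | B2 (v.2, v.1)].
  apply/seteqP; split=> -[x y] /=; rewrite /B2 /B1 /B' /= addrA;
    rewrite (_ : D / a * y + _ = a' * x + b' * y + c') //; rewrite /D; field; exact: a0.
rewrite (area_preimage_swap mB2) [LHS](area_preimage_shear a0 mh mB1).
rewrite (area_preimage_swap mB') [X in (_ * X)%E](area_preimage_shear D1 mg mB).
rewrite muleA -EFinM; congr (_%:E * _)%E.
by rewrite -invfM -normrM -/D; congr (`|_|^-1); field.
Qed.

(** When a is 0, b is not, and exchanging the coordinates leads to the previous
case. *)
Lemma area_preimage_affine (a b c a' b' c' : R) B :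
  a * b' - b * a' != 0 -> measurable B ->
  area [set v | B (a * v.1 + b * v.2 + c, a' * v.1 + b' * v.2 + c')] =
  (`|a * b' - b * a'|^-1%:E * area B)%E.
Proof.
have [->|a0] := eqVneq a 0; last exact: area_preimage_affine0.
rewrite mul0r sub0r oppr_eq0 mulf_eq0 negb_or => /andP[b0 a'0] mB.
have D0 : b * a' - 0 * b' != 0 by rewrite mul0r subr0 mulf_neq0.
have := @area_preimage_affine0 b 0 c b' a' c' B b0 D0 mB.
rewrite mul0r subr0 normrN => <-.
have m1 : measurable [set v : mplane R | B (b * v.1 + 0 * v.2 + c, b' * v.1 + a' * v.2 + c')].
  have mf : measurable_fun setT (fun v : mplane R =>
     (b * v.1 + 0 * v.2 + c, b' * v.1 + a' * v.2 + c') : mplane R).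
    apply: measurable_fun_pair; apply: measurable_funD; try exact: measurable_cst;
      apply: measurable_funD; apply: measurable_funM;
      try exact: measurable_cst; try exact: measurable_fst; exact: measurable_snd.
  by have := mf measurableT _ mB; rewrite setTI.
rewrite -(area_preimage_swap m1); congr area; apply/seteqP; split=> v /=;
  rewrite !mul0r ?add0r ?addr0 [a' * _ + _]addrC //.
Qed.

Definition std_triangle : set (mplane R) := [set v | 0 <= v.2 <= v.1 /\ v.1 <= 1].

Lemma measurable_std_triangle : measurable std_triangle.
Proof.
have m1 := @measurable_fst _ _ line line; have m2 := @measurable_snd _ _ line line.
have mc (x : R) : measurable_fun setT (cst x : mplane R -> R) by exact: measurable_cst.
have := measurable_and (measurable_and (measurable_fun_ler (mc 0) m2)
  (measurable_fun_ler m2 m1)) (measurable_fun_ler m1 (mc 1)).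
move=> /(_ measurableT [set true] I); rewrite setTI; congr measurable.
by apply/seteqP; split=> v /=; [move=> /andP|move=> [-> ->]].
Qed.

Lemma area_std_triangle : area std_triangle = (2^-1)%:E.
Proof.
rewrite /area /product_measure1 /=.
pose p : {poly R} := 2^-1 *: 'X^2.
transitivity (\int[leb]_(x in `[0%R, 1%R]) ((deriv p).[x])%:E)%E; last first.
  by rewrite integral_deriv_poly // /p !hornerE /=; congr EFin; field.
rewrite [RHS]integral_mkcond; apply: eq_integral => x _ /=.
rewrite patchE mem_setE in_itv /=.
have pE : (deriv p).[x] = x by rewrite /p !poly.derivE !hornerE /=; field.
case: ifP => [/andP[x0 x1]|xn].
  rewrite (_ : xsection _ x = `[0, x]%classic).
    by rewrite lebesgue_measure_itv /= lte_fin pE; case: ltgtP x0 => // [_|<-] _; rewrite ?sube0.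
  apply/seteqP; split=> y; rewrite /xsection /= in_itv /= in_setE /std_triangle /=.
    by case.
  by move=> ->.
rewrite (_ : xsection _ x = set0) ?measure0 //.
apply/seteqP; split=> y //; rewrite /xsection /= in_setE /std_triangle /=.
by move=> [/andP[y0 yx] x1]; rewrite (le_trans y0 yx) x1 in xn.
Qed.

End affine_area.

(** * Affine normalisation of the triangle *)

Section normalisation.
Context (R : realType) (p0 p1 p2 : plane R).
Hypothesis hT : nondegenerate_triangle p0 p1 p2.

Let e1 : plane R := p1 - p0.
Let e2 : plane R := p2 - p1.
Let D : R := det e1 e2.

Lemma det_neq0 : D != 0.
Proof.
have : nondegenerate_triangle p0 p1 p2 := hT.
rewrite /nondegenerate_triangle free_cons span_seq1 => /andP[nv]; rewrite seq1_free => v0.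
apply: contra nv => /eqP D0; apply/vlineP.
set u := p1 - p0; set v := p2 - p0 in v0 *.
have {}D0 : det u v = 0.
  by rewrite -[RHS]D0 /D /e1 /e2 /u /v /det /=; ring.
move: u v v0 D0 => [x y] [x' y'] v0; rewrite /det /= => D0.
have [x0|x0] := eqVneq x' 0.
  have y0 : y' != 0.
    by apply: contra v0 => /eqP y0; rewrite x0 y0.
  exists (y / y'); apply: injective_projections; rewrite /= /GRing.scale /=.
    have : x * y' = 0 by rewrite -[RHS]D0 x0; ring.
    by move/eqP; rewrite mulf_eq0 (negbTE y0) orbF => /eqP ->; rewrite x0 mulr0.
  by rewrite divfK.
exists (x / x'); apply: injective_projections; rewrite /= /GRing.scale /=.
  by rewrite divfK.
apply: (mulIf x0); rewrite mulrAC divfK //.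
by apply/esym/eqP; rewrite -subr_eq0 D0.
Qed.

(** Cramer's rule for the coordinates along p1 - p0 and p2 - p1; p0, p1 and p2 go
to (0, 0), (1, 0) and (1, 1). *)
Definition normalise (v : mplane R) : mplane R :=
  (e2.2 / D * v.1 + - e2.1 / D * v.2 + (p0.2 * e2.1 - p0.1 * e2.2) / D,
   - e1.2 / D * v.1 + e1.1 / D * v.2 + (p0.1 * e1.2 - p0.2 * e1.1) / D).

Lemma measurable_normalise : measurable_fun setT normalise.
Proof.
have mlin (a b c : R) : measurable_fun setT (fun v : mplane R => a * v.1 + b * v.2 + c).
  apply: measurable_funD; last exact: measurable_cst.
  apply: measurable_funD; apply: measurable_funM; try exact: measurable_cst.
    exact: measurable_fst.
  exact: measurable_snd.
by apply: measurable_fun_pair; exact: mlin.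
Qed.

Lemma normaliseK (v : plane R) :
  v = p0 + (normalise v).1 *: e1 + (normalise v).2 *: e2.
Proof.
have D0 := det_neq0.
have E1 : v.1 = p0.1 + (normalise v).1 * e1.1 + (normalise v).2 * e2.1 :> R.
  rewrite /normalise; cbn [fst snd]; move: D0; rewrite /D /det.
  by move: (e1.1) (e1.2) (e2.1) (e2.2) => a b c d D0; field.
have E2 : v.2 = p0.2 + (normalise v).1 * e1.2 + (normalise v).2 * e2.2 :> R.
  rewrite /normalise; cbn [fst snd]; move: D0; rewrite /D /det.
  by move: (e1.1) (e1.2) (e2.1) (e2.2) => a b c d D0; field.
by apply: injective_projections; [exact: E1|exact: E2].
Qed.

Lemma normaliseE (v : mplane R) (x y : R) :
  v = p0 + x *: e1 + y *: e2 :> plane R -> normalise v = (x, y).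
Proof.
have D0 := det_neq0; move=> vE.
have E1 : v.1 = p0.1 + x * e1.1 + y * e2.1 :> R by rewrite vE.
have E2 : v.2 = p0.2 + x * e1.2 + y * e2.2 :> R by rewrite vE.
rewrite /normalise E1 E2; move: D0; rewrite /D /det.
move: (e1.1) (e1.2) (e2.1) (e2.2) => a b c d D0.
by apply: injective_projections; cbn [fst snd]; field.
Qed.

Lemma normalise0 : normalise p0 = (0, 0).
Proof. by apply: normaliseE; rewrite !scale0r !addr0. Qed.

Lemma normalise1 : normalise p1 = (1, 0).
Proof. by apply: normaliseE; rewrite scale0r scale1r addr0 addrC subrK. Qed.

Lemma normalise2 : normalise p2 = (1, 1).
Proof. by apply: normaliseE; rewrite !scale1r [p0 + _]addrC subrK addrC subrK. Qed.

Lemma normalise_conv (u v : plane R) (t : R) : normalise (t *: u + (1 - t) *: v) =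
  (t * (normalise u).1 + (1 - t) * (normalise v).1,
   t * (normalise u).2 + (1 - t) * (normalise v).2).
Proof.
rewrite /normalise; apply: injective_projections; cbn [fst snd].
  by move: (e2.2 / D) (- e2.1 / D) (_ / D) => a b c; rewrite /= /GRing.scale /=; ring.
by move: (- e1.2 / D) (e1.1 / D) (_ / D) => a b c; rewrite /= /GRing.scale /=; ring.
Qed.

Lemma triangleE : triangle p0 p1 p2 = [set v | std_triangle (normalise v)].
Proof.
apply/seteqP; split.
  apply: convex_hull_min => [u v t /andP[t0 t1]|v].
    rewrite /=; move: (normalise_conv u v t) => E.
    move=> hu hv; suff : std_triangle (normalise (t *: u + (1 - t) *: v)) by [].
    rewrite E; move: hu hv; rewrite /std_triangle /=.
    move: (normalise u) (normalise v) => [x y] [x' y'] /=.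
    move=> [/andP[h1 h2] h3] [/andP[h1' h2'] h3'].
    have t1' : 0 <= 1 - t by rewrite subr_ge0.
    split; last by have := ler_wpM2l t0 h3; have := ler_wpM2l t1' h3'; lra.
    apply/andP; split; first by rewrite addr_ge0 // mulr_ge0.
    by apply: lerD; apply: ler_wpM2l.
  have vert w x y : normalise w = (x, y) -> std_triangle (x, y) ->
    std_triangle (normalise w) by move=> ->.
  move=> [[->|->]|->].
  - by apply: (vert _ _ _ normalise0); rewrite /std_triangle /= lexx ler01.
  - by apply: (vert _ _ _ normalise1); rewrite /std_triangle /= lexx ler01.
  - by apply: (vert _ _ _ normalise2); rewrite /std_triangle /= lexx ler01.
move=> v; have := normaliseK v; rewrite -[[set _ | _] v]/(std_triangle (normalise v)).
move: (normalise v) => [x y]; rewrite /std_triangle /= => vE [/andP[y0 yx] x1].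
have hp0 : triangle p0 p1 p2 p0 by apply: sub_convex_hull; left; left.
have hp1 : triangle p0 p1 p2 p1 by apply: sub_convex_hull; left; right.
have hp2 : triangle p0 p1 p2 p2 by apply: sub_convex_hull; right.
have [x0|x_neq0] := eqVneq x 0.
  have y_0 : y = 0 by apply/eqP; rewrite eq_le y0 andbT -x0.
  by move: vE; rewrite x0 y_0 !scale0r !addr0 => ->.
have x0 : 0 < x by rewrite lt_def x_neq0 (le_trans y0).
have -> : v = x *: ((y / x) *: p2 + (1 - y / x) *: p1) + (1 - x) *: p0.
  rewrite vE /e1 /e2; apply: injective_projections; rewrite /= /GRing.scale /=; by field.
apply: convex_hull_stable; [by rewrite (ltW x0)|apply: convex_hull_stable => //|exact: hp0].
by rewrite divr_ge0 ?(ltW x0) // ler_pdivrMr // mul1r.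
Qed.

Lemma measurable_triangle : measurable (triangle p0 p1 p2 : set (mplane R)).
Proof.
rewrite triangleE -[X in measurable X]setTI.
by apply: measurable_normalise => //; exact: measurable_std_triangle.
Qed.

Lemma area_preimage_normalise (B : set (mplane R)) : measurable B ->
  area (normalise @^-1` B) = (`|D|%:E * area B)%E.
Proof.
move=> mB; have D0 := det_neq0.
have E : e2.2 / D * (e1.1 / D) - - e2.1 / D * (- e1.2 / D) = D^-1.
  move: D0; rewrite /D /det.
  by move: (e1.1) (e1.2) (e2.1) (e2.2) => a b c d D0; field.
have := @area_preimage_affine R (e2.2 / D) (- e2.1 / D) ((p0.2 * e2.1 - p0.1 * e2.2) / D)
  (- e1.2 / D) (e1.1 / D) ((p0.1 * e1.2 - p0.2 * e1.1) / D) B.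
rewrite E invr_eq0 normfV invrK => /(_ D0 mB) <-.
by [].
Qed.

Section uniform_law.
Context (mu : probability (mplane R) R).
Hypothesis mu_uniform : forall A : set (mplane R), measurable A ->
  mu A = (area (A `&` triangle p0 p1 p2) / area (triangle p0 p1 p2))%E.

Let area_T : area (triangle p0 p1 p2) = (`|D| / 2)%:E.
Proof.
rewrite triangleE -/(normalise @^-1` _) area_preimage_normalise; last exact: measurable_std_triangle.
by rewrite area_std_triangle.
Qed.

Let D_gt0 : 0 < `|D|.
Proof. by rewrite normr_gt0 det_neq0. Qed.

Lemma uniform_triangle_full : mu (triangle p0 p1 p2) = 1%E.
Proof.
rewrite mu_uniform ?setIid; last exact: measurable_triangle.
by rewrite area_T divee // eqe mulf_neq0 ?invr_eq0 // gt_eqF.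
Qed.

(** The standard triangle has area 1/2, and determinants cancel. *)
Lemma uniform_triangle_law (A : set (mplane R)) : measurable A ->
  (mu (normalise @^-1` A) <= 2%:E * area A)%E.
Proof.
move=> mA.
have mA' : measurable (normalise @^-1` A).
  by rewrite -[X in measurable X]setTI; exact: measurable_normalise.
have mT := measurable_triangle.
rewrite mu_uniform // area_T.
apply: (@le_trans _ _ (area (normalise @^-1` A) / (`|D| / 2)%:E)%E).
  apply: lee_wpmul2r.
    by rewrite inver gt_eqF ?divr_gt0 // lee_fin invr_ge0 divr_ge0.
  by apply: le_measure; rewrite ?inE //; exact: measurableI.
rewrite area_preimage_normalise // inver gt_eqF ?divr_gt0 //.
rewrite muleAC -EFinM invfM invrK mulrA mulfV ?mul1r // gt_eqF //.
Qed.

End uniform_law.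

End normalisation.

(** * Expected length of a longest chain *)

Lemma ordered_chain_take (R : realType) (k : nat) (a b s : R) (l : seq (R * R)) :
  ordered_chain a b s l -> ordered_chain a b s (take k l).
Proof.
by elim: l k a b s => [|v l IH] [|k] a b s //= /andP[-> /IH]; apply.
Qed.

Lemma measure_bigsetU_seq_le (R : realType) d (T : measurableType d)
    (mu : {measure set T -> \bar R}) (I : Type) (s : seq I) (A : I -> set T) (c : R) :
  (forall i, measurable (A i)) -> (forall i, (mu (A i) <= c%:E)%E) ->
  (mu (\big[setU/set0]_(i <- s) A i) <= ((size s)%:R * c)%:E)%E.
Proof.
move=> mA Ac; elim: s => [|i s IH]; first by rewrite big_nil measure0 mul0r.
rewrite big_cons; apply: le_trans (measureU2 _ _ _) _ => //.
  exact: bigsetU_measurable.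
by rewrite /= -natr1 mulrDl mul1r addrC EFinD; apply: leeD.
Qed.

Lemma chain_coef_le (R : realType) (k : nat) :
  chain_coef R k <= 2 ^+ k / (k`!%:R) ^+ 3.
Proof.
elim: k => [|k IH]; first by rewrite fact0 expr0 expr1n divr1.
rewrite /= factS natrM exprMn [2 ^+ _.+1]exprS.
have k0 : 0 < k.+1%:R :> R by rewrite ltr0n.
have f0 : 0 < k`!%:R :> R by rewrite ltr0n fact_gt0.
have -> : 2 * 2 ^+ k / (k.+1%:R ^+ 3 * k`!%:R ^+ 3) =
  2 ^+ k / k`!%:R ^+ 3 * (2 / (k.+1%:R ^+ 2 * k.+1%:R)) :> R.
  move: k0 f0; move: (k.+1%:R) (k`!%:R) (2 ^+ k) => x y z x0 y0.
  by field; rewrite !gt_eqF.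
apply: ler_pM; rewrite ?chain_coef_ge0 //.
rewrite ler_pM2l // lef_pV2 ?posrE ?mulr_gt0 ?exprn_gt0 ?ltr0n //.
by rewrite ler_pM2l ?exprn_gt0 // ler_nat.
Qed.

Lemma expR1_le (R : realType) : expR 1 <= 27 / 8 :> R.
Proof.
have h : expR (1 / 3) <= 3 / 2 :> R.
  have := @expR_ge1Dx R (- (1 / 3)); rewrite expRN => h.
  rewrite -[expR _]invrK -[3 / 2]invrK lef_pV2 ?posrE ?invr_gt0 ?expR_gt0 //.
  by apply: le_trans h; lra.
have -> : expR 1 = expR (1 / 3) ^+ 3 :> R by rewrite -expRM_natl; congr expR; field.
have -> : 27 / 8 = (3 / 2) ^+ 3 :> R by field.
by rewrite lerXn2r // nnegrE ?expR_ge0.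
Qed.

Lemma expn_le_fact (R : realType) (k : nat) :
  k%:R ^+ k <= (27 / 8) ^+ k * k`!%:R :> R.
Proof.
case: k => [|k]; first by rewrite !expr0 fact0 mulr1.
have f0 : 0 < k.+1`!%:R :> R by rewrite ltr0n fact_gt0.
rewrite -ler_pdivrMr //.
apply: (@le_trans _ _ (expR k.+1%:R)).
  by apply: le_trans (expR_ge1Dxn k (ler0n _ _)); rewrite lerDr.
by rewrite -[k.+1%:R]mulr1 expRM_natl lerXn2r ?expR1_le // nnegrE ?expR_ge0.
Qed.

(** Since k! >= (8 k / 27)^k, the bound is at most
(2 (27/8)^3 n / k^3)^k, and 154 is a round number above 4 (27/8)^3. *)
Lemma union_bound_le (R : realType) (n k : nat) : (154 * n <= k ^ 3)%N ->
  n%:R ^+ k * chain_coef R k <= (2^-1) ^+ k.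
Proof.
move=> nk.
have f0 : 0 < k`!%:R :> R by rewrite ltr0n fact_gt0.
apply: le_trans (ler_wpM2l (exprn_ge0 _ (ler0n _ _)) (chain_coef_le R k)) _.
rewrite mulrA ler_pdivrMr ?exprn_gt0 //.
have [->|k_gt0] := posnP k; first by rewrite !expr0 fact0 expr1n !mulr1.
have h3 : (k%:R ^+ 3) ^+ k <= ((27 / 8) ^+ 3) ^+ k * k`!%:R ^+ 3 :> R.
  rewrite -!exprM ![(3 * k)%N]mulnC !exprM -exprMn lerXn2r ?expn_le_fact // nnegrE ?mulr_ge0 ?exprn_ge0 //.
have h4 : n%:R * 154 <= k%:R ^+ 3 :> R by rewrite mulrC -natrX -natrM ler_nat.
have h5 : (n%:R * 154) ^+ k <= (k%:R ^+ 3) ^+ k :> R.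
  by rewrite lerXn2r // nnegrE ?mulr_ge0 ?exprn_ge0.
have h6 : (2 * (27 / 8) ^+ 3 * 2) ^+ k <= 154 ^+ k :> R.
  by rewrite lerXn2r ?nnegrE ?mulr_ge0 ?exprn_ge0 //; lra.
have c0 : 0 < ((27 / 8) ^+ 3) ^+ k :> R by rewrite !exprn_gt0 //; lra.
rewrite -(ler_pM2l c0).
apply: (@le_trans _ _ ((2^-1) ^+ k * (k%:R ^+ 3) ^+ k)); last first.
  by rewrite [leRHS]mulrCA ler_wpM2l ?exprn_ge0 ?invr_ge0.
apply: (@le_trans _ _ ((2^-1) ^+ k * (n%:R * 154) ^+ k)); last first.
  by rewrite ler_wpM2l ?exprn_ge0 ?invr_ge0.
apply: (@le_trans _ _ ((2^-1) ^+ k * (n%:R ^+ k * (2 * (27 / 8) ^+ 3 * 2) ^+ k))); last first.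
  by rewrite [(_ * 154) ^+ k]exprMn !ler_wpM2l ?exprn_ge0 ?invr_ge0 ?ler0n.
rewrite [(2 * _ * 2) ^+ k]exprMn [(2 * _) ^+ k]exprMn le_eqVlt; apply/orP; left; apply/eqP.
have : (2^-1) ^+ k * 2 ^+ k = 1 :> R by rewrite -exprMn mulVf // expr1n.
move: ((2^-1) ^+ k) (2 ^+ k) (n%:R ^+ k) (((27 / 8) ^+ 3) ^+ k) => x y z w xy.
rewrite (_ : x * (z * (y * w * y)) = x * y * (w * (z * y))); last by ring.
by rewrite xy mul1r.
Qed.

Lemma cube_le_exp2 (k : nat) : (k ^ 3 <= 154 * 2 ^ k)%N.
Proof.
have [k4|] := leqP k 3; first by move: k k4 => [|[|[|[|]]]].
elim: k => // k IH; rewrite ltnS leq_eqVlt => /predU1P[<-//|k4].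
have := IH k4; move: (2 ^ k)%N (expnS 2 k) => q -> h.
apply: (@leq_trans (2 * k ^ 3)); last by move: (k ^ 3)%N h => c; lia.
rewrite !expnS !expn0 !muln1; nia.
Qed.

Section first_moment.
Context (R : realType) (p0 p1 p2 : plane R).
Hypothesis hT : nondegenerate_triangle p0 p1 p2.
Context (mu : probability (mplane R) R).
Hypothesis mu_uniform : forall A : set (mplane R), measurable A ->
  mu A = (area (A `&` triangle p0 p1 p2) / area (triangle p0 p1 p2))%E.
Context (n : nat) (rho : probability (n.-tuple (mplane R)) R) (rhoP : iid_law mu rho).

Let Z := config_size (@chain_config R p0 p2 n).
Let phi := normalise p0 p1 p2.

(** Composing a linear functional with the affine inverse of the normalisation
gives a linear functional plus a constant, so exposed families stay exposed. *)
Lemma ordered_chain_of_exposed_family (t : n.-tuple (mplane R)) (J : {set 'I_n}) :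
  (forall i, triangle p0 p1 p2 (tnth t i)) -> exposed_family p0 p2 t J ->
  exists L : seq 'I_n, [/\ uniq L, size L = #|J| &
    ordered_chain 0 0 0 [seq (phi (tnth t i) : R * R) | i <- L]].
Proof.
move=> tT eJ.
have [||i iJ|x xJ|L [uL _ sL oL]] := @ordered_chain_of_exposed R 'I_n J
    (fun x => phi (vertex p0 p2 t x)).
- exact: (normalise0 hT).
- exact: (normalise2 hT).
- by have := tT i; rewrite (triangleE hT).
- have [q xq] := eJ x xJ.
  exists (lin (ratr q.1) (ratr q.2) (p1 - p0)), (lin (ratr q.1) (ratr q.2) (p2 - p1)).
  move=> y yJ yx; have := xq y yJ yx; rewrite /exposes.
  have E v : lin (ratr q.1) (ratr q.2) v = lin (ratr q.1) (ratr q.2) p0 +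
     (lin (ratr q.1) (ratr q.2) (p1 - p0) * (phi v).1 +
      lin (ratr q.1) (ratr q.2) (p2 - p1) * (phi v).2).
    by rewrite {1}(normaliseK hT v) !linD !linZ !linD -/(phi v); ring.
  by rewrite (E (vertex p0 p2 t x)) (E (vertex p0 p2 t y)) ltrD2l.
by exists L.
Qed.

Lemma endpoints_neq : p0 != p2.
Proof.
apply: contraTneq (oner_neq0 R) => p02.
have : phi p0 = phi p2 by rewrite p02.
by rewrite /phi (normalise0 hT) (normalise2 hT) => -[<-]; rewrite eqxx.
Qed.

Lemma chain_config0 (t : n.-tuple (mplane R)) : chain_config p0 p2 t finset.set0.
Proof. by apply/asboolP; apply: exposed_family0; exact: endpoints_neq. Qed.

Lemma measurable_chain_config (J : {set 'I_n}) :
  measurable [set t | chain_config p0 p2 t J].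
Proof.
rewrite (_ : [set t | _] = [set t | exposed_family p0 p2 t J]).
  exact: measurable_exposed_family.
by apply/seteqP; split=> t /asboolP.
Qed.

(** A union bound over all sequences of k indices; the event that some point
falls outside the triangle is null. *)
Lemma config_size_tail (k : nat) :
  (rho [set t | (k <= Z t)%N] <= (n%:R ^+ k * chain_coef R k)%:E)%E.
Proof.
have mT := measurable_triangle hT.
have mphi := @measurable_normalise R p0 p1 p2.
pose full := box (fun _ : 'I_n => triangle p0 p1 p2).
have mfull : measurable full by exact: measurable_box.
have rho_full : rho (~` full) = 0%E.
  rewrite probability_setC // (_ : rho full = 1%E) ?subee //.
  rewrite rhoP // big1 // => i _; exact: uniform_triangle_full.
pose A (L : k.-tuple 'I_n) : set (n.-tuple (mplane R)) :=
  if uniq L then [set t | ordered_chain 0 0 0 [seq (phi (tnth t i) : R * R) | i <- L]]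
  else set0.
have mA L : measurable (A L).
  rewrite /A; case: ifP => _; last exact: measurable0.
  exact: (measurable_ordered_chain_tuple mphi).
have mZ : measurable [set t | (k <= Z t)%N].
  case: k {A mA} => [|k]; first by rewrite (_ : [set t | _] = setT) //; apply/seteqP; split.
  exact: (measurable_gt_config_size k measurable_chain_config).
have AP L : (rho (A L) <= (chain_coef R k)%:E)%E.
  rewrite /A; case: ifP => uL; last by rewrite measure0 lee_fin chain_coef_ge0.
  have := @ordered_chain_prob R _ _ n mu rho rhoP phi mphi (uniform_triangle_law hT mu_uniform)
     L 0 0 0 uL ler01.
  rewrite mul0r !subr0 ler01 => /(_ isT); rewrite size_tuple /narea.
  by rewrite mul0r !subr0 mulr1 expr1n mulr1.
have sub : [set t | (k <= Z t)%N] `<=` ~` full `|` \big[setU/set0]_(L <- enum {: k.-tuple 'I_n}) A L.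
  move=> t /= kZ; have [ft|nft] := pselect (full t); last by left.
  right; have [J /asboolP QJ JZ] := config_size_attained chain_config0 t.
  (* A longest chain may have more than k points; its first k suffice. *)
  have [L [uL sL oL]] := ordered_chain_of_exposed_family ft QJ.
  have sk : size (take k L) == k by rewrite size_take_min sL JZ; apply/eqP/minn_idPl.
  rewrite -bigcup_seq; exists (Tuple sk); first by rewrite /= mem_enum.
  rewrite /A /= take_uniq //= map_take; exact: ordered_chain_take.
apply: le_trans (le_measure _ _ _ sub) _; rewrite ?inE //.
  by apply: measurableU; [exact: measurableC|exact: bigsetU_measurable].
apply: le_trans (measureU2 _ _ _) _; [exact: measurableC|exact: bigsetU_measurable|].
have le1 : (rho (~` full) <= 0)%E by rewrite rho_full.
apply: le_trans (leeD le1 (measure_bigsetU_seq_le (enum {: k.-tuple 'I_n}) mA AP)) _.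
by rewrite add0e -cardE card_tuple card_ord natrX.
Qed.

(** The length is at most k - 1, except on an event of probability at most
2^(-k), where it is at most n; and n <= 2^k. *)
Lemma mean_config_size_le (k : nat) : (0 < k)%N -> (154 * n <= k ^ 3)%N ->
  \int[rho]_t (Z t)%:R <= k%:R :> R.
Proof.
move=> k0 nk; pose A := [set t | (k <= Z t)%N].
have mA : measurable A.
  case: k k0 @A {nk} => // k _.
  exact: (measurable_gt_config_size k measurable_chain_config).
have bA : bounded_measurable (\1_A : n.-tuple (mplane R) -> R).
  apply: (@bmeas_itv _ _ _ _ 0 1); first exact: measurable_indic.
  by move=> t; rewrite indicE ler0n lern1 leq_b1.
have bn : bounded_measurable (fun t => n%:R * \1_A t : R).
  by apply: bmeasM => //; exact: bmeas_cst.
apply: (@le_trans _ _ (\int[rho]_t (k.-1%:R + n%:R * \1_A t))).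
  apply: bmean_le.
  - exact: (bmeas_config_fun measurable_chain_config (fun z => z%:R)).
  - by apply: bmeasD => //; exact: bmeas_cst.
  move=> t; rewrite indicE; have [kZ|kZ] := leqP k (Z t).
    rewrite mem_set // mulr1 -natrD ler_nat.
    by apply: leq_trans (config_size_le _ _) _; rewrite leq_addl.
  rewrite memNset /=; last by apply/negP; rewrite -ltnNge.
  by rewrite mulr0 addr0 ler_nat -ltnS prednK.
rewrite bmeanD //; last exact: bmeas_cst.
rewrite (bmean_cst rho k.-1%:R) bmeanZ //.
have tail : \int[rho]_t \1_A t <= (2^-1) ^+ k :> R.
  rewrite -lee_fin -bmean_EFin // integral_indic // setIT.
  by apply: le_trans (config_size_tail k) _; rewrite lee_fin; exact: union_bound_le.
have n2 : n%:R * (2^-1) ^+ k <= 1 :> R.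
  rewrite exprVn ler_pdivrMr ?exprn_gt0 // mul1r -natrX ler_nat.
  by have := leq_trans nk (cube_le_exp2 k); rewrite leq_pmul2l.
rewrite -[X in _ <= X%:R](prednK k0) -natr1 lerD2l.
exact: le_trans (ler_wpM2l (ler0n R n) tail) n2.
Qed.

End first_moment.

(** * Choice of the constants *)

(** With b = n^(1/6) and M = 6 b^2, the main term s^2 / (2 M) equals
gamma^2 (ln n) / 12.  As ln n <= 6 b, the ratio s / M is at most 1/20 once b is
large, and the correction factor is then at least 12/13; this leaves the rate
1/13, and the gap 1/13 - 1/14 = 1/182 absorbs the factor 2 <= exp 1. *)
Lemma parameter_choice (R : realType) (gamma : R) : 0 < gamma ->
  exists N : nat, forall n : nat, (N < n)%N ->
  let s := gamma * Num.sqrt (ln n%:R) * n%:R `^ 6^-1 in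
  exists k (M : R), [/\ (0 < k)%N /\ (154 * n <= k ^ 3)%N, k%:R <= M, 0 < M,
    0 <= s <= M / 2 &
    2 * expR (- (s ^+ 2 / (2 * M) * (1 - 4 / 3 * (s / M)))) <
    n%:R `^ (- (gamma ^+ 2 / 14))].
Proof.
move=> g0.
pose C := 70 * gamma ^+ 2 + 2.
pose x := Num.max (C ^+ 6) (expR (182 / gamma ^+ 2)).
exists (Num.trunc x) => n Nn s.
have g2 : 0 < gamma ^+ 2 by rewrite exprn_gt0.
have C2 : 2 <= C by rewrite /C; lra.
have C0 : 0 < C by lra.
have x0 : 0 <= x by rewrite le_max exprn_ge0 // ltW.
have xn : x < n%:R.
  by have /andP[_ /lt_le_trans] := truncn_itv x0; apply; rewrite ler_nat.
have nC : C ^+ 6 < n%:R by rewrite (le_lt_trans _ xn) // le_max lexx.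
have ne : expR (182 / gamma ^+ 2) < n%:R by rewrite (le_lt_trans _ xn) // le_max lexx orbT.
have n0 : 0 < n%:R :> R by rewrite (lt_trans _ ne) // expR_gt0.
pose b : R := n%:R `^ 6^-1.
have b0 : 0 < b by rewrite powR_gt0.
have b6 : b ^+ 6 = n%:R.
  by rewrite -powR_mulrn ?ltW // -powRrM mulVf // powRr1 // ltW.
have Cb : C <= b.
  by rewrite leNgt; apply/negP => bC; move: nC; rewrite -b6 ltNge lerXn2r ?nnegrE ?ltW.
have ln_n : 182 / gamma ^+ 2 < ln n%:R.
  by rewrite -[X in X < _]expRK ltr_ln ?posrE ?expR_gt0.
have ln0 : 0 < ln n%:R :> R by rewrite (lt_trans _ ln_n) // divr_gt0.
have lnb : ln n%:R <= 6 * b.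
  rewrite -b6 lnXn // -[_ *+ 6]mulr_natl; have := ln_sublinear b0; lra.
pose M := 6 * b ^+ 2.
have M0 : 0 < M by rewrite mulr_gt0 // exprn_gt0.
pose k := (Num.trunc (11 / 2 * b ^+ 2)).+1.
have bb0 : 0 <= 11 / 2 * b ^+ 2 by rewrite mulr_ge0 // sqr_ge0.
have /andP[k1 k2] := truncn_itv bb0.
have b4 : 4 <= b ^+ 2 by nra.
have s0 : 0 <= s by rewrite !mulr_ge0 // ?sqrtr_ge0 // ltW.
have s2 : s ^+ 2 = gamma ^+ 2 * ln n%:R * b ^+ 2.
  by rewrite /s -/b !exprMn sqr_sqrtr // ltW.
have sM : s / M <= 1 / 20.
  rewrite ler_pdivrMr // mul1r -ler_pdivrMl ?invr_gt0 // invrK.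
  have s20 : 0 <= 20 * s by rewrite mulr_ge0.
  rewrite -(@ler_pXn2r _ 2) ?nnegrE ?(ltW M0) // exprMn s2 /M exprMn.
  have gC : 70 * gamma ^+ 2 <= b by move: Cb; rewrite /C; lra.
  have h1 : gamma ^+ 2 * ln n%:R <= gamma ^+ 2 * (6 * b) by rewrite ler_wpM2l // ltW.
  have h2 : 70 * (gamma ^+ 2 * b) <= b ^+ 2.
    by rewrite expr2 mulrA ler_wpM2r // ltW.
  have b2 : 0 <= b ^+ 2 by exact: sqr_ge0.
  have h3 : 400 * (gamma ^+ 2 * ln n%:R) <= 36 * b ^+ 2 by lra.
  have := ler_wpM2r b2 h3.
  by rewrite ![_ ^+ 2 ^+ 2]expr2 ![6 ^+ 2]expr2 ![20 ^+ 2]expr2; lra.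
exists k, M; split.
- split=> //; rewrite -(ler_nat R) natrM natrX -b6.
  apply: (@le_trans _ _ ((11 / 2 * b ^+ 2) ^+ 3)).
    rewrite exprMn -exprM /= ler_wpM2r ?exprn_ge0 ?(ltW b0) //; lra.
  by rewrite lerXn2r ?nnegrE // ltW.
- rewrite /k -natr1 /M; lra.
- by [].
- by rewrite s0 /=; move: sM; rewrite ler_pdivrMr //; lra.
have -> : s ^+ 2 / (2 * M) = gamma ^+ 2 * ln n%:R / 12.
  by rewrite s2 /M; field; rewrite gt_eqF.
rewrite /powR gt_eqF //.
have e2 : 2 <= expR 1 :> R by have := @expR_ge1Dx R 1; lra.
apply: (@le_lt_trans _ _ (expR 1 * expR (- (gamma ^+ 2 * ln n%:R / 13)))).
  apply: ler_pM; rewrite ?expR_ge0 // ler_expR lerN2.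
  set L := gamma ^+ 2 * ln n%:R.
  have L0 : 0 <= L by rewrite mulr_ge0 ?sqr_ge0 // ltW.
  have : 1 - 4 / 3 * (s / M) >= 12 / 13 by lra.
  by move=> /(ler_wpM2l L0); lra.
rewrite -expRD ltr_expR.
have : gamma ^+ 2 * (182 / gamma ^+ 2) < gamma ^+ 2 * ln n%:R by rewrite ltr_pM2l.
rewrite mulrC divfK ?gt_eqF //; lra.
Qed.

(** * Concentration of the longest chain *)

Section joint_law.
Context (R : realType) (d d' : measure_display) (Omega : measurableType d)
  (V : measurableType d') (P : probability Omega R) (n : nat)
  (X : 'I_n -> {RV P >-> V}).

Definition joint (w : Omega) : n.-tuple V := [tuple X i w | i < n].

Lemma measurable_joint : measurable_fun setT joint.
Proof.
apply/measurable_fun_tnthP => i.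
rewrite (_ : _ \o _ = X i) //; apply/funext => w /=; exact: tnth_mktuple.
Qed.

Definition joint_RV : {RV P >-> n.-tuple V} := mfun_Sub (mem_set measurable_joint).

Lemma iid_law_joint (mu : probability V R) : independent_RVs X ->
  (forall i A, measurable A -> P (X i @^-1` A) = mu A) ->
  iid_law mu (distribution P joint_RV).
Proof.
move=> indX law A mA.
rewrite -[LHS]/(P (joint @^-1` box A)).
have := indX [set: 'I_n]%SET A (fun i _ => mA i).
rewrite (_ : \bigcap_(i in _) _ = joint @^-1` box A).
  move=> ->; under eq_bigl do rewrite finset.in_setT.
  by apply: eq_bigr => i _; exact: law.
apply/seteqP; split=> w /= h i; first by rewrite tnth_mktuple; apply: h; rewrite /= finset.in_setT.
by move=> _; have := h i; rewrite tnth_mktuple.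
Qed.

End joint_law.

Theorem theorem2p8 (R : realType) (p0 p1 p2 : plane R)
    (hT : nondegenerate_triangle p0 p1 p2) (gamma : R) (hgamma : 0 < gamma) :
  exists N : nat, forall n : nat, (N < n)%N ->
  forall (d : measure_display) (Omega : measurableType d)
    (P : probability Omega R) (X : 'I_n -> {RV P >-> mplane R}),
    independent_RVs X ->
    (forall i, uniform_on (triangle p0 p1 p2) (X i)) ->
    (P [set w | (gamma * Num.sqrt (ln n%:R) * n%:R `^ 6^-1)%:E
                < `| (chain_length p0 p2 X w)%:E - 'E_P[chain_length p0 p2 X] |]
     < (n%:R `^ (- (gamma ^+ 2 / 14)))%:E)%E.
Proof.
have [N HN] := parameter_choice hgamma; exists N => n Nn d Omega P X indX unifX.
have [k [M [[k0 nk] kM M0 sM bound]]] := HN n Nn.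
pose i0 : 'I_n := Ordinal (leq_ltn_trans (leq0n N) Nn).
pose mu := distribution P (X i0); pose rho := distribution P (joint_RV X).
have muE (A : set (mplane R)) : measurable A ->
    mu A = (area (A `&` triangle p0 p1 p2) / area (triangle p0 p1 p2))%E.
  exact: unifX.
have rhoP : iid_law mu rho.
  apply: iid_law_joint => // i A mA.
  exact: etrans (unifX i A mA) (esym (muE A mA)).
set s := gamma * _ * _ in sM bound *.
pose Q := @chain_config R p0 p2 n.
pose Z (t : n.-tuple (mplane R)) : R := (config_size Q t)%:R.
have lengthE w : chain_length p0 p2 X w = Z (joint_RV X w).
  by rewrite /chain_length /sample longest_convex_chainE.
have mQ : forall J, measurable [set t | Q t J] by exact: measurable_chain_config.
have mZ : measurable_fun setT Z by exact: measurable_config_size.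
pose m : R := \int[rho]_t Z t.
have bZ : bounded_measurable Z by exact: (bmeas_config_fun mQ (fun z => z%:R)).
have meanE : ('E_P[chain_length p0 p2 X] = m%:E)%E.
  rewrite -bmean_EFin // ge0_integral_distribution //.
  - by rewrite unlock; apply: eq_integral => w _; rewrite /= -lengthE.
  - exact/measurable_EFinP.
  - by move=> t; rewrite lee_fin ler0n.
have mM : m <= M.
  by apply: le_trans kM; exact: (mean_config_size_le hT muE rhoP).
rewrite meanE.
have -> : P [set w | (s%:E < `|(chain_length p0 p2 X w)%:E - m%:E|)%E] =
    rho [set t | s < `|Z t - m|].
  congr (P _); apply/seteqP; split=> w /=; by rewrite lengthE.
have Qlocal t t' (J : {set 'I_n}) :
    (forall i, i \in J -> tnth t i = tnth t' i) -> Q t J -> Q t' J.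
  by move=> tt' /asboolP h; apply/asboolP; exact: exposed_family_local h.
have QS t (J K : {set 'I_n}) : K \subset J -> Q t J -> Q t K.
  by move=> KJ /asboolP h; apply/asboolP; exact: exposed_familyS h.
have := @config_concentration _ _ _ n mu rho rhoP Q (chain_config0 hT (n := n)) QS Qlocal mQ s M mM M0 sM.
by move=> /le_lt_trans; apply; rewrite lte_fin.
Qed.
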